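(* Let $L/K$ be a finite Galois extension of number fields with Galois group $G$. Then there is an exact sequence of abelian groups $$\{0\} \rightarrow \operatorname{Ker}(\epsilon_{L/K}) \rightarrow H^1(G,U_L) \rightarrow \bigoplus_{\mathfrak{P}\ \text{prime of } K} \mathbb{Z}/e_{\mathfrak{P}}\mathbb{Z} \rightarrow \frac{\operatorname{Po}(L/K)}{\epsilon_{L/K}(\operatorname{Cl}(K))} \rightarrow \{0\}.$$
   Context: For a number field $M$, $\mathcal{O}_M$ is its ring of integers, $\operatorname{Cl}(M)$ its ideal class group, and $U_M=\mathcal{O}_M^{\times}$ its group of units. For a finite extension $L/K$ of number fields, $\epsilon_{L/K}:\operatorname{Cl}(K)\to\operatorname{Cl}(L)$ is the homomorphism induced by extension of ideals $\mathfrak{a}\mapsto \mathfrak{a}\mathcal{O}_L$. For a nonzero prime ideal $\mathfrak{P}$ of $\mathcal{O}_K$ and a positive integer $f$, put $$\Pi_{\mathfrak{P}^f}(L/K)=\prod_{\mathfrak{M}\in \mathrm{Max}(\mathcal{O}_L),\ N_{L/K}(\mathfrak{M})=\mathfrak{P}^f}\mathfrak{M},$$ where $N_{L/K}$ is the ideal norm (an empty product is $\mathcal{O}_L$). The relative Pólya group $\operatorname{Po}(L/K)$ is the subgroup of $\operatorname{Cl}(L)$ generated by the classes of all the ideals $\Pi_{\mathfrak{P}^f}(L/K)$. When $L/K$ is Galois, $e_{\mathfrak{P}}$ denotes the ramification index of the nonzero prime ideal $\mathfrak{P}$ of $\mathcal{O}_K$ in $L/K$, and $\epsilon_{L/K}(\operatorname{Cl}(K))$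 is a subgroup of $\operatorname{Po}(L/K)$. $H^1(G,U_L)$ is the first group cohomology group for the Galois action of $G$ on $U_L$. *)

(* Defs.v *)
From HB Require Import structures.
From mathcomp Require Import all_boot all_order all_algebra all_fingroup.
From mathcomp Require Import all_solvable all_field.
From mathcomp Require Import mathcomp_extra boolp classical_sets functions.
From mathcomp Require Import cardinality fsbigop.
From mathcomp Require Import generic_quotient ring_quotient.

Set Implicit Arguments.
Unset Strict Implicit.
Unset Printing Implicit Defensive.

Import GRing.Theory.
Local Open Scope classical_set_scope.
Local Open Scope ring_scope.

(* Abelian groups are zmodTypes and are written additively throughout, also   *)
(* the class groups, the groups of fractional ideals and the unit groups.     *)

Identity Coercion set_to_fun : set >-> Funclass.

Section Subgroups.
Variable A : zmodType.

Record subgrp := Subgrp {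
  subgrp_set :> set A;
  subgrp_closed : subgrp_set 0 /\
    forall x y, subgrp_set x -> subgrp_set y -> subgrp_set (x - y) }.

Definition subgrp_mem (H : subgrp) : A -> bool := fun x => `[< H x >].

Lemma subgrp_mem_closed H : zmod_closed (subgrp_mem H).
Proof.
have [H0 HB] := subgrp_closed H.
by split=> [|x y /asboolP Hx /asboolP Hy]; apply/asboolP; [|exact: HB].
Qed.

HB.instance Definition _ H :=
  GRing.isZmodClosed.Build A (subgrp_mem H) (subgrp_mem_closed H).

Definition subgrp_pred (H : subgrp) : zmodClosed A :=
  GRing.ZmodClosed.clone A (subgrp_mem H) _.

Definition subgrp_type (H : subgrp) := {x : A | subgrp_mem H x}.
HB.instance Definition _ H := SubChoice.on (subgrp_type H).
HB.instance Definition _ H :=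
  GRing.SubChoice_isSubZmodule.Build A (subgrp_mem H) (subgrp_type H)
    (subgrp_mem_closed H).

Definition quot_type (H : subgrp) := Quotient.quot (subgrp_pred H).
HB.instance Definition _ H := GRing.Zmodule.on (quot_type H).

Definition quot_pi (H : subgrp) (x : A) : quot_type H :=
  (\pi_(Quotient.quot (subgrp_pred H)) x)%qT.

Lemma quot_pi_is_additive H : zmod_morphism (quot_pi H).
Proof. exact: raddfB. Qed.
HB.instance Definition _ H :=
  GRing.isZmodMorphism.Build A (quot_type H) (quot_pi H)
    (quot_pi_is_additive H).

Lemma quot_piP H x y : (quot_pi H x = quot_pi H y) <-> H (x - y).
Proof.
rewrite -[H _]asboolE -/(subgrp_mem H (x - y)).
rewrite -[subgrp_mem _ _]/(x - y \in subgrp_mem H) Quotient.idealrBE.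
by split=> /eqP.
Qed.

Definition quot_repr H (c : quot_type H) : A := repr c.

Lemma quot_reprK H c : quot_pi H (quot_repr c) = c.
Proof. exact: reprK. Qed.

Lemma subgrp_gen_closed (S : set A) :
  let G := smallest (fun H => H 0 /\ forall x y, H x -> H y -> H (x - y)) S in
  G 0 /\ forall x y, G x -> G y -> G (x - y).
Proof.
split=> [H [[H0 _] _] //|x y Gx Gy H HS].
by apply: HS.1.2; [apply: Gx|apply: Gy].
Qed.

Definition subgrp_gen (S : set A) : subgrp := Subgrp (subgrp_gen_closed S).

End Subgroups.

Section ImageKernel.
Variables (A B : zmodType) (f : {additive A -> B}).

Lemma subgrp_ker_closed : let N := [set x | f x = 0] in
  N 0 /\ forall x y, N x -> N y -> N (x - y).
Proof.
split=> [|x y /= fx fy] /=; first exact: raddf0.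
by rewrite raddfB fx fy subr0.
Qed.

Definition subgrp_ker : subgrp A := Subgrp subgrp_ker_closed.

Lemma subgrp_im_closed : let N := range f in
  N 0 /\ forall x y, N x -> N y -> N (x - y).
Proof.
split=> [|_ _ [x _ <-] [y _ <-]]; first by exists 0 => //; exact: raddf0.
by exists (x - y) => //; exact: raddfB.
Qed.

Definition subgrp_im : subgrp B := Subgrp subgrp_im_closed.

Lemma subgrp_preim_closed (H : subgrp B) : let N := f @^-1` H in
  N 0 /\ forall x y, N x -> N y -> N (x - y).
Proof.
have [H0 HB] := subgrp_closed H.
by split=> [|x y Hx Hy]; rewrite /preimage /= ?raddf0 // raddfB; exact: HB.
Qed.

Definition subgrp_preim (H : subgrp B) : subgrp A :=
  Subgrp (subgrp_preim_closed H).

End ImageKernel.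

(* The quotient of H by N; only used for N contained in H. *)
Definition subquot_type (A : zmodType) (H N : subgrp A) : zmodType :=
  quot_type (subgrp_preim (val : {additive subgrp_type H -> A}) N).

Section IntegerModules.
Variable M : fieldType.

Definition OI : set M := [set x | integralOver (intr : int -> M) x].

Lemma OI0 : OI 0. Proof. exact: integral0. Qed.
Lemma OI1 : OI 1. Proof. exact: integral1. Qed.
Lemma OID x y : OI x -> OI y -> OI (x + y). Proof. exact: integral_add. Qed.
Lemma OIM x y : OI x -> OI y -> OI (x * y). Proof. exact: integral_mul. Qed.

Definition Omod_closed (I : set M) :=
  [/\ I 0, forall x y, I x -> I y -> I (x + y)
    & forall a x, OI a -> I x -> I (a * x)].

(* The O_M-submodules of M; with sum and product of modules they form a       *)
(* commutative semiring, whose 1 is O_M and whose 0 is the zero module.       *)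
Record Omod := MkOmod { Omod_set :> set M; OmodP : Omod_closed Omod_set }.

HB.instance Definition _ := gen_eqMixin Omod.
HB.instance Definition _ := gen_choiceMixin Omod.

Implicit Types (I J N : Omod) (S : set M).

Lemma Omod_eq I J : I `<=` J -> J `<=` I -> I = J.
Proof.
case: I J => [I Ip] [J Jp] /= IJ JI.
have E : I = J by apply/seteqP.
by move: Ip Jp; rewrite E => Ip Jp; congr MkOmod; exact: Prop_irrelevance.
Qed.

Lemma Ospan_closed S : Omod_closed (smallest Omod_closed S).
Proof.
split=> [I [[]] //|x y Sx Sy I IS|a x Oa Sx I IS]; have [[_ ID IZ] _] := IS.
  by apply: ID; [apply: Sx|apply: Sy].
by apply: IZ => //; apply: Sx.
Qed.

Definition Ospan S : Omod := MkOmod (Ospan_closed S).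

Lemma Ospan_sub S I : S `<=` I -> Ospan S `<=` I.
Proof. by apply: smallest_sub; exact: OmodP. Qed.

Lemma sub_Ospan S : S `<=` Ospan S.
Proof. exact: sub_gen_smallest. Qed.

Lemma Ozero_closed : Omod_closed [set 0].
Proof.
by split=> [//|x y -> ->|a x _ ->]; rewrite /= ?addr0 ?mulr0.
Qed.

Lemma Oone_closed : Omod_closed OI.
Proof. by split; [exact: OI0|exact: OID|exact: OIM]. Qed.

Definition Ozero : Omod := MkOmod Ozero_closed.
Definition Oone : Omod := MkOmod Oone_closed.
Definition Oadd I J : Omod := Ospan (I `|` J).
Definition Omul I J : Omod := Ospan [set x * y | x in I & y in J].

Lemma Oadd_sub I J N : (Oadd I J `<=` N) <-> (I `<=` N /\ J `<=` N).
Proof.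
split=> [IJN|[IN JN]]; last first.
  by apply: Ospan_sub => x [Ix|Jx]; [exact: IN|exact: JN].
by split=> x Hx; apply: IJN; apply: sub_Ospan; [left|right].
Qed.

Lemma Oadd_subl I J : I `<=` Oadd I J.
Proof. by case/Oadd_sub: (@subset_refl _ (Oadd I J)). Qed.
Lemma Oadd_subr I J : J `<=` Oadd I J.
Proof. by case/Oadd_sub: (@subset_refl _ (Oadd I J)). Qed.

Lemma Ocolon_closed N J : Omod_closed [set x | forall y, J y -> N (x * y)].
Proof.
have [N0 ND NZ] := OmodP N.
split=> [y _|x z Nx Nz y Jy|a x Oa Nx y Jy] /=; first by rewrite mul0r.
- by rewrite mulrDl; apply: ND; [exact: Nx|exact: Nz].
- by rewrite -mulrA; apply: NZ => //; exact: Nx.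
Qed.

Definition Ocolon N J : Omod := MkOmod (Ocolon_closed N J).

Lemma Omul_colon I J N : (Omul I J `<=` N) <-> (I `<=` Ocolon N J).
Proof.
split=> [IJN x Ix y Jy|IN]; last first.
  by apply: Ospan_sub => _ [x Ix [y Jy <-]]; exact: IN.
by apply: IJN; apply: sub_Ospan; exists x => //; exists y.
Qed.

Lemma Omul_sub I J N :
  (Omul I J `<=` N) <-> (forall x y, I x -> J y -> N (x * y)).
Proof.
rewrite Omul_colon; split=> IN x => [y Ix|Ix y]; first exact: IN.
exact: IN.
Qed.

Lemma Omul_mem I J x y : I x -> J y -> Omul I J (x * y).
Proof. by have /Omul_sub := @subset_refl _ (Omul I J); apply. Qed.

Lemma Omul_sub_comm I J : Omul I J `<=` Omul J I.
Proof. by apply/Omul_sub => x y Ix Jy; rewrite mulrC; exact: Omul_mem. Qed.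

Lemma OmulC : commutative Omul.
Proof. by move=> I J; apply: Omod_eq; exact: Omul_sub_comm. Qed.

Lemma Omul_sub_assoc I J N : Omul (Omul I J) N `<=` Omul I (Omul J N).
Proof.
apply/Omul_colon/Omul_sub => x y Ix Jy z Nz.
by rewrite -mulrA; do 2?[apply: Omul_mem => //].
Qed.

Lemma OmulA : associative Omul.
Proof.
move=> I J N; apply: Omod_eq; last exact: Omul_sub_assoc.
rewrite OmulC [Omul J N]OmulC [Omul (Omul I J) _]OmulC [Omul I J]OmulC.
exact: Omul_sub_assoc.
Qed.

Lemma Omul1 : left_id Oone Omul.
Proof.
move=> I; have [_ _ IZ] := OmodP I; apply: Omod_eq.
  by apply/Omul_sub => a x; exact: IZ.
by move=> x Ix; rewrite -[x]mul1r; apply: Omul_mem => //; exact: OI1.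
Qed.

Lemma Omul0 : left_zero Ozero Omul.
Proof.
move=> I; apply: Omod_eq; first by apply/Omul_sub => _ x -> _ /=; rewrite mul0r.
by move=> _ ->; case: (OmodP (Omul Ozero I)).
Qed.

Lemma OaddC : commutative Oadd.
Proof. by move=> I J; rewrite /Oadd setUC. Qed.

Lemma OaddA : associative Oadd.
Proof.
move=> I J N; apply: Omod_eq; apply/Oadd_sub; split.
- by move=> x Ix; do 2!apply: Oadd_subl.
- apply/Oadd_sub; split=> x Hx; last exact: Oadd_subr.
  by apply: Oadd_subl; exact: Oadd_subr.
- apply/Oadd_sub; split=> x Hx; first exact: Oadd_subl.
  by apply: Oadd_subr; exact: Oadd_subl.
- by move=> x Nx; do 2!apply: Oadd_subr.
Qed.

Lemma Oadd0 : left_id Ozero Oadd.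
Proof.
move=> I; apply: Omod_eq; last exact: Oadd_subr.
by apply/Oadd_sub; split=> // _ ->; case: (OmodP I).
Qed.

Lemma OmulDl : left_distributive Omul Oadd.
Proof.
move=> I J N; apply: Omod_eq.
  apply/Omul_colon/Oadd_sub; split; apply/Omul_colon;
    [exact: Oadd_subl|exact: Oadd_subr].
apply/Oadd_sub; split; apply/Omul_sub => x y Hx Hy; apply: Omul_mem => //;
  [exact: Oadd_subl|exact: Oadd_subr].
Qed.

HB.instance Definition _ := GRing.isNmodule.Build Omod OaddA OaddC Oadd0.
HB.instance Definition _ := GRing.Nmodule_isComPzSemiRing.Build Omod
  OmulA OmulC Omul1 OmulDl Omul0.

Lemma Oprinc_closed x : Omod_closed [set a * x | a in OI].
Proof.
split=> [|_ _ [a Oa <-] [b Ob <-]|a _ Oa [b Ob <-]].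
- by exists 0; [exact: OI0|rewrite mul0r].
- by exists (a + b); [exact: OID|rewrite mulrDl].
- by exists (a * b); [exact: OIM|rewrite mulrA].
Qed.

Definition Oprinc x : Omod := MkOmod (Oprinc_closed x).

Lemma Oprinc_mem x : Oprinc x x.
Proof. by exists 1; [exact: OI1|rewrite mul1r]. Qed.

Lemma Oprinc_sub x I : (Oprinc x `<=` I) <-> I x.
Proof.
have [_ _ IZ] := OmodP I.
by split=> [|Ix _ [a Oa <-]]; [apply; exact: Oprinc_mem|exact: IZ].
Qed.

Lemma Oprinc1 : Oprinc 1 = 1.
Proof.
apply: Omod_eq => [_ [a Oa <-]|x Ox]; first by rewrite mulr1.
by exists x => //; rewrite mulr1.
Qed.

Lemma OprincM x y : Oprinc (x * y) = Oprinc x * Oprinc y.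
Proof.
apply: Omod_eq; first by apply/Oprinc_sub; apply: Omul_mem; exact: Oprinc_mem.
apply/Omul_sub => _ _ [a Oa <-] [b Ob <-]; exists (a * b); first exact: OIM.
by rewrite mulrACA.
Qed.

Definition fractional I :=
  I <> 0 /\ exists d : M, [/\ d != 0, OI d & forall x, I x -> OI (d * x)].

Lemma Omul_neq0 I J : I <> 0 -> J <> 0 -> I * J <> 0.
Proof.
have nz N : N <> 0 <-> exists2 x, N x & x != 0.
  split=> [N0|[x Nx x0] N0]; last by move: Nx; rewrite N0 => /eqP; apply/negP.
  apply: contrapT => hN; apply: N0; apply: Omod_eq.
    move=> x Nx; apply: contrapT => x0; apply: hN.
    by exists x => //; apply/eqP.
  by move=> _ ->; case: (OmodP N).
move=> /nz[x Ix x0] /nz[y Jy y0]; apply/nz.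
by exists (x * y); [exact: Omul_mem|rewrite mulf_neq0].
Qed.

Lemma fractionalM I J : fractional I -> fractional J -> fractional (I * J).
Proof.
case=> I0 [d [d0 Od dI]] [J0 [e [e0 Oe eJ]]]; split; first exact: Omul_neq0.
exists (d * e); split; [by rewrite mulf_neq0|exact: OIM|].
suff h : Omul I J `<=` Ocolon 1 (Oprinc (d * e)).
  by move=> x /h /(_ _ (Oprinc_mem _)); rewrite mulrC.
apply/Omul_sub => x y Ix Jy _ [a Oa <-]; rewrite mulrC -mulrA mulrACA.
by apply: OIM => //; apply: OIM; [exact: dI|exact: eJ].
Qed.

Lemma fractional1 : fractional 1.
Proof.
split=> [E|]; last first.
  exists 1; split=> [||x Ox]; [exact: oner_neq0|exact: OI1|by rewrite mul1r].
have : (0 : Omod) 1 by rewrite -E; exact: OI1.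
by apply/eqP; exact: oner_neq0.
Qed.

End IntegerModules.

Arguments OI : clear implicits.
Arguments Ospan {M} S : simpl never.
Arguments Omul {M} I J : simpl never.
Arguments Oadd {M} I J : simpl never.

(* The group of invertible fractional ideals, i.e. the unit group of the      *)
(* monoid of fractional ideals (every fractional ideal of a number field is   *)
(* invertible). An element is the pair of the ideal and its inverse.          *)
Section ClassGroup.
Variable M : fieldType.

Definition fracideal_pred (p : Omod M * Omod M) : bool :=
  `[< [/\ fractional p.1, fractional p.2 & p.1 * p.2 = 1] >].

Definition fracideal := {p : Omod M * Omod M | fracideal_pred p}.
HB.instance Definition _ := Choice.on fracideal.
HB.instance Definition _ := SubType.on fracideal.

Definition fracideal_ideal (I : fracideal) : Omod M := (val I).1.

Lemma fracideal_inj : injective fracideal_ideal.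
Proof.
case=> [[I I'] p] [[J J'] q] IJ; apply: val_inj; move: IJ.
rewrite /fracideal_ideal /= => IJ; move: p; rewrite IJ => /asboolP[_ _ /= E].
have [_ _ /= F] := asboolP _ q; congr (_, _).
by rewrite -[I']mul1r -F mulrAC E mul1r.
Qed.

Fact fracideal_0P : fracideal_pred (1, 1).
Proof. by apply/asboolP; split; rewrite ?mulr1 //; exact: fractional1. Qed.

Fact fracideal_oppP (I : fracideal) : fracideal_pred ((val I).2, (val I).1).
Proof.
by case: I => p /= /asboolP[? ? ?]; apply/asboolP; split; rewrite // mulrC.
Qed.

Fact fracideal_addP (I J : fracideal) :
  fracideal_pred ((val I).1 * (val J).1, (val I).2 * (val J).2).
Proof.
case: I J => p /= /asboolP[? ? pE] [q /= /asboolP[? ? qE]]; apply/asboolP.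
by split; [exact: fractionalM|exact: fractionalM|rewrite /= mulrACA pE qE mulr1].
Qed.

Definition fracideal_0 : fracideal := Sub (1, 1) fracideal_0P.
Definition fracideal_opp I : fracideal := Sub _ (fracideal_oppP I).
Definition fracideal_add I J : fracideal := Sub _ (fracideal_addP I J).

Fact fracideal_addA : associative fracideal_add.
Proof. by move=> I J N; apply: fracideal_inj; exact: mulrA. Qed.
Fact fracideal_addC : commutative fracideal_add.
Proof. by move=> I J; apply: fracideal_inj; exact: mulrC. Qed.
Fact fracideal_add0 : left_id fracideal_0 fracideal_add.
Proof. by move=> I; apply: fracideal_inj; exact: mul1r. Qed.
Fact fracideal_addN : left_inverse fracideal_0 fracideal_opp fracideal_add.
Proof.
case=> p pP; apply: fracideal_inj; have [_ _ E] := asboolP _ pP.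
exact: etrans (mulrC _ _) E.
Qed.

HB.instance Definition _ := GRing.isZmodule.Build fracideal
  fracideal_addA fracideal_addC fracideal_add0 fracideal_addN.

Lemma fracideal_idealD I J :
  fracideal_ideal (I + J) = fracideal_ideal I * fracideal_ideal J.
Proof. by []. Qed.

Lemma fracideal_idealN I : fracideal_ideal I * fracideal_ideal (- I) = 1.
Proof. by rewrite -fracideal_idealD subrr. Qed.

Lemma principal_closed :
  let P := [set I : fracideal |
    exists2 x : M, x != 0 & fracideal_ideal I = Oprinc x] in
  P 0 /\ forall I J, P I -> P J -> P (I - J).
Proof.
split=> [|I J [x x0 Ix] [y y0 Jy]] /=.
  by exists 1; [exact: oner_neq0|rewrite Oprinc1].
exists (x / y); first by rewrite mulf_neq0 ?invr_neq0.
rewrite OprincM fracideal_idealD -Ix; congr (_ * _).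
rewrite -[RHS]mulr1 -(fracideal_idealN J) Jy mulrA -OprincM mulVf //.
by rewrite Oprinc1 mul1r.
Qed.

Definition principal : subgrp fracideal := Subgrp principal_closed.

Definition Cl : zmodType := quot_type principal.

Definition ideal_class (I : fracideal) : Cl := quot_pi principal I.

Lemma ideal_class_is_additive : zmod_morphism ideal_class.
Proof. exact: raddfB. Qed.
HB.instance Definition _ := GRing.isZmodMorphism.Build fracideal Cl
  ideal_class ideal_class_is_additive.

Definition is_prime_ideal (P : Omod M) :=
  [/\ P `<=` OI M, ~ P 1 &
      forall x y, OI M x -> OI M y -> P (x * y) -> P x \/ P y].

Definition is_maximal_ideal (P : Omod M) :=
  [/\ P `<=` OI M, ~ P 1 &
      forall J : Omod M, P `<=` J -> J `<=` OI M -> ~ J 1 -> J = P].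

(* The nonzero prime ideals of O_M. *)
Definition prime_of := {P : Omod M | is_prime_ideal P /\ P <> 0}.

End ClassGroup.

Section Extension.
Variables (K : fieldType) (L : fieldExtType K).

Lemma OI_in_alg (a : K) : OI K a -> OI L a%:A.
Proof.
case=> p p_mon pa0; exists p => //.
have -> : map_poly (intr : int -> L) p = map_poly (in_alg L) (map_poly intr p).
  by rewrite -map_poly_comp; apply: eq_map_poly => n; exact/esym/rmorph_int.
by rewrite -[a%:A]/(in_alg L a) fmorph_root.
Qed.

Lemma alg_scalarM (a b : K) : (a * b)%:A = a%:A * b%:A :> L.
Proof. exact: (rmorphM (in_alg L)). Qed.

Lemma alg_scalar_eq0 (a : K) : (a%:A == 0 :> L) = (a == 0).
Proof. exact: (fmorph_eq0 (in_alg L)). Qed.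

Lemma contract_closed (J : Omod L) : Omod_closed [set a : K | J a%:A].
Proof.
have [J0 JD JZ] := OmodP J; split=> [|a b Ja Jb|a b Oa Jb] /=.
- by rewrite scale0r.
- by rewrite scalerDl; exact: JD.
- by rewrite alg_scalarM; apply: JZ => //; exact: OI_in_alg.
Qed.

Definition contract (J : Omod L) : Omod K := MkOmod (contract_closed J).

(* I O_L *)
Definition extend (I : Omod K) : Omod L := Ospan [set a%:A | a in I].

Lemma extend_sub (I : Omod K) (J : Omod L) : (extend I `<=` J) <-> (I `<=` contract J).
Proof.
split=> [IJ a Ia|IJ]; first by apply: IJ; apply: sub_Ospan; exists a.
by apply: Ospan_sub => _ [a Ia <-]; exact: IJ.
Qed.

Lemma extend_mem (I : Omod K) a : I a -> extend I a%:A.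
Proof. by have /extend_sub := @subset_refl _ (extend I); apply. Qed.

Lemma extend_princ a : extend (Oprinc a) = Oprinc a%:A.
Proof.
apply: Omod_eq; first by apply/extend_sub/Oprinc_sub; exact: Oprinc_mem.
by apply/Oprinc_sub; apply: extend_mem; exact: Oprinc_mem.
Qed.

Lemma extend1 : extend 1 = 1.
Proof. by rewrite -Oprinc1 extend_princ scale1r Oprinc1. Qed.

Lemma extendM (I J : Omod K) : extend (I * J) = extend I * extend J.
Proof.
apply: Omod_eq.
  apply/extend_sub/Omul_sub => a b Ia Jb.
  suff : Omul (extend I) (extend J) (a%:A * b%:A) by rewrite -alg_scalarM.
  by apply: Omul_mem; exact: extend_mem.
apply: (Omul_colon _ _ _).2; apply/extend_sub => a Ia.
suff h : extend J `<=` Ocolon (extend (I * J)) (Oprinc a%:A).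
  move=> y Jy /=; rewrite [_ * y]mulrC; exact: (h y Jy _ (Oprinc_mem _)).
apply/extend_sub => b Jb _ [c Oc <-].
have [_ _ eZ] := OmodP (extend (I * J)).
rewrite mulrCA; apply: eZ => //; rewrite mulrC -alg_scalarM.
by apply: extend_mem; exact: Omul_mem.
Qed.

Lemma extend_fractional (I : Omod K) : fractional I -> fractional (extend I).
Proof.
case=> I0 [d [d0 Od dI]]; split=> [E|].
  apply: I0; apply: Omod_eq => [a Ia|_ ->]; last by case: (OmodP I).
  have : (0 : Omod L) a%:A by rewrite -E; exact: extend_mem.
  by move=> /eqP; rewrite alg_scalar_eq0 => /eqP.
exists d%:A; split; [by rewrite alg_scalar_eq0|exact: OI_in_alg|].
suff h : extend I `<=` Ocolon 1 (Oprinc d%:A).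
  by move=> x /h /(_ _ (Oprinc_mem _)); rewrite mulrC.
apply/extend_sub => a Ia _ [c Oc <-].
rewrite mulrCA; apply: OIM => //.
rewrite mulrC -alg_scalarM.
by apply: OI_in_alg; exact: dI.
Qed.

Fact extend_fracidealP (I : fracideal K) :
  fracideal_pred (extend (val I).1, extend (val I).2).
Proof.
case: I => p /= /asboolP[? ? E]; apply/asboolP.
by split; rewrite /= -?extendM ?E ?extend1 //; exact: extend_fractional.
Qed.

Definition extend_fracideal (I : fracideal K) : fracideal L :=
  Sub _ (extend_fracidealP I).

Lemma extend_fracideal_is_additive : zmod_morphism extend_fracideal.
Proof. by move=> I J; apply: fracideal_inj; exact: extendM. Qed.

HB.instance Definition _ := GRing.isZmodMorphism.Build (fracideal K)
  (fracideal L) extend_fracideal extend_fracideal_is_additive.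

Definition epsilon (c : Cl K) : Cl L :=
  ideal_class (extend_fracideal (quot_repr c)).

Lemma epsilonE I : epsilon (ideal_class I) = ideal_class (extend_fracideal I).
Proof.
apply/quot_piP; rewrite -raddfB.
have /quot_piP[x x0 E] := quot_reprK (ideal_class I).
exists x%:A; first by rewrite alg_scalar_eq0.
by rewrite -extend_princ -E.
Qed.

Lemma epsilon_is_additive : zmod_morphism epsilon.
Proof.
move=> c d; rewrite -{1}[c]quot_reprK -{1}[d]quot_reprK -raddfB epsilonE.
rewrite (raddfB extend_fracideal); exact: raddfB.
Qed.

HB.instance Definition _ := GRing.isZmodMorphism.Build (Cl K) (Cl L)
  epsilon epsilon_is_additive.

End Extension.

Section Polya.
Variables (K : fieldType) (L : splittingFieldType K).

(* The ideal of O_K generated by the norms of the elements of I; the norm of  *)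
(* an element is the product of its conjugates because L/K will be Galois.    *)
Definition ideal_norm (I : Omod L) : Omod K :=
  Ospan [set a : K | exists2 x : L, I x & a%:A = galNorm 1 {:L} x].

(* The index set is finite (its members lie above P), as \big over a set      *)
(* requires to be meaningful.                                                 *)
Definition Pi_ideal (P : Omod K) (f : nat) : Omod L :=
  \big[*%R/1]_(m \in [set m : Omod L |
                        is_maximal_ideal m /\ ideal_norm m = P ^+ f]) m.

Definition Po : subgrp (Cl L) :=
  subgrp_gen [set c | exists (P : prime_of K) (f : nat) (I : fracideal L),
    [/\ (0 < f)%N, fracideal_ideal I = Pi_ideal (sval P) f
      & c = ideal_class I]].

(* The common value e of the ramification indices e(m/P), for m above P; by   *)
(* definition e(m/P) is the exponent of m in the factorization of P O_L.      *)
Definition ramification_index (P : prime_of K) : nat :=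
  xget 0%N [set e | forall m : Omod L, is_maximal_ideal m ->
    extend L (sval P) `<=` m ->
    extend L (sval P) `<=` m ^+ e /\ ~ (extend L (sval P) `<=` m ^+ e.+1)].

End Polya.

Section Units.
Variable M : fieldType.

Definition Ounit_pred (u : M) : bool := `[< [/\ u != 0, OI M u & OI M u^-1] >].

Definition Ounit := {u : M | Ounit_pred u}.
HB.instance Definition _ := Choice.on Ounit.
HB.instance Definition _ := SubType.on Ounit.

Fact Ounit_0P : Ounit_pred 1.
Proof.
by apply/asboolP; rewrite invr1; split; rewrite ?oner_neq0 //; exact: OI1.
Qed.

Fact Ounit_oppP (u : Ounit) : Ounit_pred (val u)^-1.
Proof.
case: u => u /= /asboolP[? ? ?]; apply/asboolP.
by split; rewrite ?invr_neq0 ?invrK.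
Qed.

Fact Ounit_addP (u v : Ounit) : Ounit_pred (val u * val v).
Proof.
case: u v => u /= /asboolP[? ? ?] [v /= /asboolP[? ? ?]]; apply/asboolP.
by split; rewrite ?mulf_neq0 ?invfM //; exact: OIM.
Qed.

Definition Ounit_0 : Ounit := Sub 1 Ounit_0P.
Definition Ounit_opp u : Ounit := Sub _ (Ounit_oppP u).
Definition Ounit_add u v : Ounit := Sub _ (Ounit_addP u v).

Fact Ounit_addA : associative Ounit_add.
Proof. by move=> u v w; apply: val_inj; exact: mulrA. Qed.
Fact Ounit_addC : commutative Ounit_add.
Proof. by move=> u v; apply: val_inj; exact: mulrC. Qed.
Fact Ounit_add0 : left_id Ounit_0 Ounit_add.
Proof. by move=> u; apply: val_inj; exact: mul1r. Qed.
Fact Ounit_addN : left_inverse Ounit_0 Ounit_opp Ounit_add.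
Proof.
by case=> u uP; apply: val_inj; case/asboolP: (uP) => u0 _ _; exact: mulVf.
Qed.

HB.instance Definition _ := GRing.isZmodule.Build Ounit
  Ounit_addA Ounit_addC Ounit_add0 Ounit_addN.

End Units.

Section Cohomology.
Variables (K : fieldType) (L : splittingFieldType K).

(* The type of K-automorphisms of L, i.e. 'Gal({:L} / 1) is the full group.   *)
Local Notation G := (gal_of {:L}).

Fact gal_unitP (s : G) (u : Ounit L) : Ounit_pred (s (val u)).
Proof.
have Os x : OI L x -> OI L (s x).
  case=> p p_mon px0; exists p => //.
  have -> : map_poly intr p = map_poly s (map_poly (intr : int -> L) p).
    by rewrite -map_poly_comp; apply: eq_map_poly => n; exact/esym/rmorph_int.
  by rewrite fmorph_root.
case: u => u /= /asboolP[? ? ?]; apply/asboolP.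
by split; rewrite ?fmorph_eq0 -?fmorphV //; exact: Os.
Qed.

Definition gal_unit (s : G) (u : Ounit L) : Ounit L := Sub _ (gal_unitP s u).

Lemma gal_unit_is_additive s : zmod_morphism (gal_unit s).
Proof.
by move=> u v; apply: val_inj; rewrite /= rmorphM fmorphV.
Qed.

HB.instance Definition _ s := GRing.isZmodMorphism.Build (Ounit L) (Ounit L)
  (gal_unit s) (gal_unit_is_additive s).

(* In a group gal_of E the product s * t is the automorphism x |-> t (s x)    *)
(* (see galM), hence the side on which t acts in the cocycle condition.       *)
Lemma cocycle_closed :
  let Z := [set c : {ffun G -> Ounit L} |
    forall s t : G, c (s * t)%g = c t + gal_unit t (c s)] in
  Z 0 /\ forall c d, Z c -> Z d -> Z (c - d).
Proof.
split=> [s t|c d Zc Zd s t]; first by rewrite !ffunE raddf0 addr0.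
by rewrite !ffunE Zc Zd raddfB opprD addrACA.
Qed.

Lemma coboundary_closed :
  let B := [set c : {ffun G -> Ounit L} |
    exists u : Ounit L, forall s : G, c s = gal_unit s u - u] in
  B 0 /\ forall c d, B c -> B d -> B (c - d).
Proof.
split=> [|c d [u cu] [v dv]].
  by exists 0 => s; rewrite !ffunE raddf0 subr0.
exists (u - v) => s; rewrite !ffunE cu dv (raddfB (gal_unit s)).
by rewrite !opprD !opprK addrACA.
Qed.

Definition cocycle : subgrp {ffun G -> Ounit L} := Subgrp cocycle_closed.
Definition coboundary : subgrp {ffun G -> Ounit L} := Subgrp coboundary_closed.

Definition H1_units : zmodType := subquot_type cocycle coboundary.

End Cohomology.

Section DirectSum.
Variables (T : Type) (A : T -> zmodType).

Definition dprod_type := forall i, A i.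
HB.instance Definition _ := gen_eqMixin dprod_type.
HB.instance Definition _ := gen_choiceMixin dprod_type.

Implicit Types f g h : dprod_type.
Let add f g : dprod_type := fun i => f i + g i.
Let opp f : dprod_type := fun i => - f i.
Let zero : dprod_type := fun=> 0.

Let addA : associative add.
Proof. by move=> f g h; apply: functional_extensionality_dep => i; exact: addrA. Qed.
Let addC : commutative add.
Proof. by move=> f g; apply: functional_extensionality_dep => i; exact: addrC. Qed.
Let add0 : left_id zero add.
Proof. by move=> f; apply: functional_extensionality_dep => i; exact: add0r. Qed.
Let addN : left_inverse zero opp add.
Proof. by move=> f; apply: functional_extensionality_dep => i; exact: addNr. Qed.

HB.instance Definition _ := GRing.isZmodule.Build dprod_type addA addC add0 addN.

Lemma dsum_closed :
  let D := [set f : dprod_type | finite_set [set i | f i <> 0]] in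
  D 0 /\ forall f g, D f -> D g -> D (f - g).
Proof.
split=> [|f g Df Dg] /=; first by apply: sub_finite_set (@finite_set0 T) => i.
have /sub_finite_set : [set i | (f - g) i <> 0] `<=`
    [set i | f i <> 0] `|` [set i | g i <> 0].
  move=> i /= fg; have [fi|] := pselect (f i = 0); last by left.
  right => gi; apply: fg; rewrite -[(f - g) i]/(f i - g i) fi gi.
  exact: subrr.
by apply; rewrite finite_setU.
Qed.

Definition dsum : zmodType := subgrp_type (Subgrp dsum_closed).

End DirectSum.

(* Z/eZ for e > 0; 'Z_e would be wrong for e = 1. *)
Definition Zmod (e : nat) : zmodType := 'I_e.-1.+1.

Definition ramification_sum (K : fieldType) (L : splittingFieldType K) :
  zmodType := dsum (fun P : prime_of K => Zmod (ramification_index L P)).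

Definition exact_at (A B C : zmodType) (f : A -> B) (g : B -> C) :=
  range f = [set b | g b = 0].

(* Main.v *)
(* A 1-cocycle of units becomes a coboundary s |-> s x / x in L^* by Hilbert  *)
(* 90, and x is determined by its class up to K^* and units; conversely such  *)
(* a cocycle has unit values exactly when the ideal (x) is G-invariant. So    *)
(* H^1(G, U_L) is the group of invariant principal ideals modulo the          *)
(* principal ideals of K. The group of all invariant fractional ideals is     *)
(* free on the products of the primes of L above a given prime P of K,        *)
(* because G permutes these transitively; the e_P-th power of that product    *)
(* is P O_L, so invariant ideals modulo the ideals extended from K form the   *)
(* direct sum of the Z/e_P, and the classes of the invariant ideals form      *)
(* Po(L/K). The map from H^1 sends (x) to its valuations modulo e_P, and the  *)
(* kernel and cokernel of the map from invariant principal ideals modulo      *)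
(* those of K to invariant ideals modulo those extended from K are            *)
(* Ker(epsilon) and Po(L/K) / epsilon(Cl(K)). Unique factorization of ideals  *)
(* is derived from the finiteness of O_M / n O_M.                             *)
From HB Require Import structures.
From mathcomp Require Import all_boot all_order all_algebra all_fingroup.
From mathcomp Require Import all_solvable all_field.
From mathcomp Require Import mathcomp_extra boolp classical_sets functions.
From mathcomp Require Import cardinality fsbigop.
From mathcomp Require Import ring.
Require Import Defs.

Set Implicit Arguments.
Unset Strict Implicit.
Unset Printing Implicit Defensive.

Import Order.TTheory GRing.Theory Num.Theory.
Local Open Scope classical_set_scope.
Local Open Scope ring_scope.

(** Write D_K for the fractional ideals of K and D_L^G for the G-invariant fractional ideals of L;
    extension embeds D_K in D_L^G ([extend_fracideal_inj]). All four terms come from a single map,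
    from the invariant principal ideals of L modulo the principal ideals of K to D_L^G / D_K. Its
    source is H^1(G, U_L), by [hilbert90], [gal_invariant_princ] and [trivialized_coboundary]. Its
    target is the sum of the Z/e_P, by [residues_map_extend], [residues_map_eq0] and
    [residues_map_surj]. Its kernel consists of the ideals of K that become principal in L, modulo
    principal ones, that is Ker(epsilon). Its cokernel is the group of classes of invariant ideals
    modulo classes extended from K, that is Po(L/K) / epsilon(Cl(K)), by [Po_classP] and
    [Po_invariant].

    The arithmetic input is that the valuations of an ideal determine it ([ord_inj]) and that those
    of an invariant ideal agree at all primes above a given P ([above_transitive], [ord_above]).
    Valuations rest on [prime_factorization], which follows from the finiteness of residue rings
    ([finite_indexP]): finiteness gives Noetherian induction ([ideal_ind]), the maximality of
    nonzero primes, and the integrality of multipliers of an ideal ([OI_stable]).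

    The three homomorphisms depend on choices of representatives, so each is given as a relation and
    made into a map by [additive_of_rel]; exactness is checked on the relations. *)

Section Modules.
Variable M : fieldType.
Implicit Types (I J : Omod M) (x y : M).

Lemma OIN x : OI M x -> OI M (- x). Proof. exact: integral_opp. Qed.

Lemma OIB x y : OI M x -> OI M y -> OI M (x - y).
Proof. exact: integral_sub. Qed.

Lemma OI_int (n : int) : OI M n%:~R.
Proof. exact: integral_id. Qed.

Lemma Omod0 I : I 0. Proof. by case: (OmodP I). Qed.
Lemma OmodD I x y : I x -> I y -> I (x + y).
Proof. by case: (OmodP I) => _ + _; apply. Qed.
Lemma OmodZ I a x : OI M a -> I x -> I (a * x).
Proof. by case: (OmodP I) => _ _; apply. Qed.
Lemma OmodZr I a x : OI M a -> I x -> I (x * a).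
Proof. by rewrite mulrC; exact: OmodZ. Qed.
Lemma OmodN I x : I x -> I (- x).
Proof. by rewrite -mulN1r; apply: OmodZ; apply: OIN; exact: OI1. Qed.
Lemma OmodB I x y : I x -> I y -> I (x - y).
Proof. by move=> Ix Iy; apply: OmodD => //; exact: OmodN. Qed.
Lemma OmodMz I x (n : int) : I x -> I (x *~ n).
Proof. by rewrite -mulrzl; apply: OmodZ; exact: OI_int. Qed.
Lemma Omod_sum I (T : Type) (r : seq T) (F : T -> M) :
  (forall i, I (F i)) -> I (\sum_(i <- r) F i).
Proof. by move=> IF; elim/big_ind: _ => //; [exact: Omod0|exact: OmodD]. Qed.
Lemma OIX x n : OI M x -> OI M (x ^+ n).
Proof.
by move=> Ox; elim: n => [|n IH]; [exact: OI1|rewrite exprS; exact: OIM].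
Qed.

Lemma Omod_neq0P I : I <> 0 <-> exists2 x, I x & x != 0.
Proof.
split=> [I0|[x Ix x0] I0]; last by move: Ix; rewrite I0 => /eqP; apply/negP.
apply: contrapT => hI; apply: I0; apply: Omod_eq => [x Ix|_ ->];
  last exact: Omod0.
by apply: contrapT => x0; apply: hI; exists x => //; apply/eqP.
Qed.

Lemma Omod_sub_neq0 I J : I `<=` J -> I <> 0 -> J <> 0.
Proof.
by move=> IJ /Omod_neq0P[x Ix x0]; apply/Omod_neq0P; exists x => //; exact: IJ.
Qed.

Lemma Omod_eq1 I : I `<=` OI M -> I 1 -> I = 1.
Proof.
move=> IO I1; apply: Omod_eq => // x Ox.
by rewrite -[x]mulr1; apply: OmodZ.
Qed.

Lemma OmulS I I' J J' : I `<=` I' -> J `<=` J' -> I * J `<=` I' * J'.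
Proof. by move=> II JJ; apply/Omul_sub => x y /II Ix /JJ Jy;
  exact: Omul_mem. Qed.

Lemma Omul_subl I J : J `<=` OI M -> I * J `<=` I.
Proof. by move=> JO; apply/Omul_sub => x y Ix /JO; rewrite mulrC => /OmodZ;
  apply. Qed.

Lemma Omul_subO I J : I `<=` OI M -> J `<=` OI M -> I * J `<=` OI M.
Proof. by move=> IO JO; apply: subset_trans IO; exact: Omul_subl. Qed.

Lemma Oprinc_subO x : OI M x -> Oprinc x `<=` OI M.
Proof. by move=> Ox; apply/(Oprinc_sub _ 1). Qed.

Lemma Oprinc_neq0 x : x != 0 -> Oprinc x <> 0.
Proof. by move=> x0; apply/Omod_neq0P; exists x => //; exact: Oprinc_mem. Qed.

Lemma integral_fractional I : I `<=` OI M -> I <> 0 -> fractional I.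
Proof.
move=> IO I0; split=> //; exists 1.
by split=> [||x Ix]; [exact: oner_neq0|exact: OI1|rewrite mul1r; exact: IO].
Qed.

Lemma Oadd_mem I J z : (I + J)%R z -> exists x y, [/\ I x, J y & z = x + y].
Proof.
have C : Omod_closed [set z | exists x y, [/\ I x, J y & z = x + y]].
  split=> [|_ _ [x [y [Ix Jy ->]]] [x' [y' [Ix' Jy' ->]]]|a _ Oa [x [y [Ix Jy ->]]]].
  - by exists 0, 0; split; rewrite ?addr0 //; exact: Omod0.
  - by exists (x + x'), (y + y'); rewrite addrACA; split => //; exact: OmodD.
  - by exists (a * x), (a * y); rewrite mulrDr; split => //; exact: OmodZ.
suff : Oadd I J `<=` MkOmod C by apply.
apply/Oadd_sub; split=> x Hx.
  by exists x, 0; split; rewrite ?addr0 //; exact: Omod0.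
by exists 0, x; split; rewrite ?add0r //; exact: Omod0.
Qed.

End Modules.

(* Characteristic 0, and finite dimension over Q, the latter in the form of *)
(* linear relations with integer coefficients.                              *)
Definition numfield (M : fieldType) :=
  injective (intr : int -> M) /\ exists d, forall k, (d < k)%N ->
    forall f : 'I_k -> M, exists c : 'I_k -> int,
      (exists i, c i != 0) /\ \sum_i f i *~ c i = 0.

Lemma numfield_ext (M : fieldExtType rat) : numfield M.
Proof.
split; first by move=> m n /eqP;
  rewrite -!(rmorph_int (in_alg M)) (inj_eq (fmorph_inj _)) eqr_int => /eqP.
exists (\dim {:M}) => -[//|k] dk f.
pose X := [tuple f i | i < k.+1].
have /freeP : ~~ free X.
  apply/negP => /eqP; rewrite size_tuple => E.
  by have := dimvS (subvf <<X>>); rewrite E leqNgt dk.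
move=> nf.
have [a [a0 [j aj]]] : exists a : 'I_k.+1 -> rat,
    \sum_(i < k.+1) a i *: X`_i = 0 /\ exists i, a i != 0.
  apply: contrapT => h; apply: nf => a a0 i; apply: contrapT => /eqP ai.
  by apply: h; exists a; split => //; exists i.
(* The rational coefficients are packed into a polynomial to obtain a common denominator [b]; [q]
   carries the integers [b * a i]. *)
have [q [b b0 E]] := rat_poly_scale (\poly_(i < k.+1) a (inord i)).
have qE (i : 'I_k.+1) : (q`_i)%:~R = b%:~R * a i :> rat.
  have := congr1 (fun p : {poly rat} => p`_i) E.
  rewrite coef_poly ltn_ord inord_val => ->.
  by rewrite coefZ coef_map /= mulVKf // intr_eq0.
exists (fun i => q`_i); split.
  exists j; apply/eqP => qj; have := qE j; rewrite qj => /eqP.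
  by rewrite eq_sym mulf_eq0 intr_eq0 (negPf b0) (negPf aj).
transitivity ((b%:~R : rat) *: \sum_(i < k.+1) a i *: X`_i);
  last by rewrite a0 scaler0.
rewrite scaler_sumr; apply: eq_bigr => i _.
by rewrite scalerA -qE scaler_int /X nth_mktuple.
Qed.

(** * Residue classes modulo ideals *)

Section FiniteIndex.
Variables (M : fieldType) (hM : numfield M).
Implicit Types (I J : Omod M) (x y : M).

Definition residues I (s : seq M) :=
  forall x, OI M x -> exists2 r, r \in s & I (x - r).

Definition finite_index I := exists s, residues I s.

Lemma numfield_nat_neq0 n : (0 < n)%N -> n%:R != 0 :> M.
Proof.
move=> n0; apply/eqP => E; have := hM.1 n%:Z 0 E.
by move=> [] /eqP; rewrite (gtn_eqF n0).
Qed.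

(** For p prime, this is linear independence over F_p of the images in O_M / p O_M. *)
Definition mod_free (p k : nat) (f : 'I_k -> M) :=
  (forall i, OI M (f i)) /\ forall c : 'I_k -> int,
    Oprinc p%:R (\sum_i f i *~ c i) -> forall i, (p%:Z %| c i)%Z.

(** Infinite descent: the coefficients of a relation are all divisible by p, and dividing by p gives
    another relation, so they are divisible by every power of p. *)
Lemma mod_free_free p k (f : 'I_k -> M) : (1 < p)%N -> mod_free p f ->
  forall c : 'I_k -> int, \sum_i f i *~ c i = 0 -> forall i, c i = 0.
Proof.
move=> p1 [_ pf].
have dv e : forall c : 'I_k -> int, \sum_i f i *~ c i = 0 ->
    forall i, ((p ^ e)%:Z %| c i)%Z.
  elim: e => [|e IH] c c0 i; first by rewrite expn0 dvd1z.
  have pc : forall i, (p%:Z %| c i)%Z by apply: pf; rewrite c0; exact: Omod0.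
  have cE j : c j = (c j %/ p%:Z)%Z * p%:Z by rewrite divzK.
  rewrite (cE i) mulrC expnS PoszM dvdz_mul2l; last first.
    by rewrite eqz_nat -lt0n ltnW.
  have p0 := numfield_nat_neq0 (ltnW p1).
  apply: (IH (fun j => (c j %/ p%:Z)%Z)); apply: (mulIf p0); rewrite /= mul0r.
  transitivity (\sum_i f i *~ c i) => //; rewrite mulr_suml;
    apply: eq_bigr => j _.
  by rewrite [in RHS]cE mulrzA -pmulrn mulr_natr.
move=> c c0 i; apply/eqP; apply: contraTT (dv `|c i|%N c c0 i) => ci.
rewrite dvdzE absz_nat; apply: contra_neqN (ci) => /dvdn_leq.
by rewrite absz_gt0 ci => /(_ isT); rewrite leqNgt ltn_expl.
Qed.

(* A maximal family that is independent modulo p is linearly independent over *)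
(* Q, hence finite; its combinations with coefficients in [0, p) represent    *)
(* all classes modulo p.                                                      *)
Lemma finite_index_prime p : prime p -> finite_index (Oprinc p%:R).
Proof.
move=> pp; have p1 := prime_gt1 pp; have [d hd] := hM.2.
pose Q k := `[< exists f : 'I_k -> M, mod_free p f >].
have Q0 : Q 0%N by apply/asboolP; exists (fun=> 0); split=> [[]|? _ []].
have Qd k : Q k -> (k <= d)%N.
  move=> /asboolP[f ff]; rewrite leqNgt; apply/negP => dk.
  have [c [[i ci] c0]] := hd k dk f.
  by move: ci; rewrite (mod_free_free p1 ff c0) eqxx.
have exQ : exists k, Q k by exists 0%N.
have [k /asboolP[f ff] kmax] := ex_maxnP exQ Qd.
have [fO fdv] := ff.
exists [seq \sum_i f i *~ (b i : 'I_p)%:Z | b : {ffun 'I_k -> 'I_p}] => x Ox.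
pose g (i : 'I_k.+1) := if unlift ord0 i is Some j then f j else x.
have ng : ~ mod_free p g.
  by move=> gg; have /kmax : Q k.+1 by [apply/asboolP; exists g]; rewrite ltnn.
have [c [cp [i ci]]] : exists c : 'I_k.+1 -> int,
    Oprinc p%:R (\sum_i g i *~ c i) /\ exists i, ~~ (p%:Z %| c i)%Z.
  apply: contrapT => h; apply: ng; split=> [i|c cp i].
    by rewrite /g; case: unliftP.
  by apply: contrapT => /negP ci; apply: h; exists c; split => //; exists i.
pose y := \sum_i f i *~ c (lift ord0 i).
have {}cp : Oprinc p%:R (x *~ c ord0 + y).
  move: cp; rewrite big_ord_recl {1}/g unlift_none; congr (Oprinc _ (_ + _)).
  by apply: eq_bigr => j _; rewrite /g liftK.
have pM z n : OI M z -> Oprinc p%:R (z *~ (n * p%:Z)).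
  move=> Oz; exists (z *~ n); last by rewrite mulrzA -pmulrn mulr_natr.
  exact: (OmodMz (I := Oone M)).
(* If p divided the coefficient of x, then [y] would lie in p O_M, and the independence of [f] would
   make every coefficient divisible by p. *)
have c0 : ~~ (p%:Z %| c ord0)%Z.
  apply/negP => c0; case/negP: ci.
  suff yp : Oprinc p%:R y.
    by case: (unliftP ord0 i) => [j ->|->] //; exact: fdv yp j.
  rewrite -[y](addKr (x *~ c ord0)) addrC; apply: OmodB => //.
  by rewrite -(divzK c0); exact: pM.
(* With u p + v c_0 = 1 and c_0 x = - y modulo p, one gets x = - v y modulo p; [w] holds the
   coefficients of - v y on [f], and [b] their remainders modulo p. *)
have : coprimez p%:Z (c ord0).
  by rewrite coprimezE absz_nat prime_coprime.
case/coprimezP => -[u v] /= uv.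
pose w j := - v * c (lift ord0 j).
have wp j : (`|(w j %% p%:Z)%Z|%N < p)%N.
  have p0 : 0 < p%:Z by rewrite ltz_nat ltnW.
  by rewrite -ltz_nat gez0_abs ?modz_ge0 ?ltz_pmod // gt_eqF.
pose b := [ffun j => Ordinal (wp j)].
exists (\sum_j f j *~ (b j)%:Z); first by apply/fintype.imageP; exists b.
have bE j : w j = (w j %/ p%:Z)%Z * p%:Z + (b j)%:Z.
  rewrite ffunE /= gez0_abs ?modz_ge0 -?divz_eq //.
  by rewrite eqz_nat -lt0n ltnW.
have -> : x - \sum_j f j *~ (b j)%:Z = x *~ (u * p%:Z) + (x *~ c ord0 + y) *~ v
   + \sum_j f j *~ ((w j %/ p%:Z)%Z * p%:Z).
  have -> : \sum_j f j *~ ((w j %/ p%:Z)%Z * p%:Z) =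
            - (y *~ v) - \sum_j f j *~ (b j)%:Z.
    apply/eqP; rewrite eq_sym subr_eq -big_split -mulrNz mulrz_suml; apply/eqP.
    by apply: eq_bigr => l _ /=; rewrite -mulrzDr -bE /w mulrC mulrzA.
  rewrite addrA; congr (_ - _); rewrite mulrzDl addrA addrK -mulrzA -mulrzDr.
  by rewrite [c _ * v]mulrC uv mulr1z.
apply: (@OmodD _ (Oprinc p%:R));
  last by apply: (@Omod_sum _ (Oprinc p%:R)) => j; exact: pM.
by apply: (@OmodD _ (Oprinc p%:R)); [exact: pM|exact: OmodMz].
Qed.

(** Representatives are built as digits: x = r + p y with r a residue modulo a prime factor p of n,
    then y is reduced modulo n / p. *)
Lemma finite_index_nat n : (0 < n)%N -> finite_index (Oprinc n%:R).
Proof.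
have [N] := ubnP n; elim: N n => // N IH n nN n0.
have [n1|n1] := leqP n 1.
  exists [:: 0] => x Ox; exists 0; rewrite ?mem_head //.
  have -> : n = 1%N by apply/eqP; rewrite eqn_leq n1.
  by rewrite Oprinc1 subr0.
have pp := pdiv_prime n1; set p := pdiv n in pp.
have nE : n = (n %/ p * p)%N by rewrite divnK // pdiv_dvd.
have m0 : (0 < n %/ p)%N by rewrite divn_gt0 ?prime_gt0 // dvdn_leq // pdiv_dvd.
have mN : (n %/ p < N)%N.
  by rewrite -ltnS (leq_ltn_trans _ nN) // ltn_Pdiv // prime_gt1.
have [s sp] := finite_index_prime pp; have [t tm] := IH _ mN m0.
exists [seq r + r' * p%:R | r <- s, r' <- t] => x Ox.
have [r rs [y Oy yE]] := sp x Ox; have [r' rt [z Oz zE]] := tm y Oy.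
exists (r + r' * p%:R); first by apply/allpairsP; exists (r, r').
exists z => //; rewrite opprD addrA -yE -mulrBl -zE -mulrA -natrM.
by rewrite -nE.
Qed.

Lemma OI_horner (p : {poly int}) x : OI M x -> OI M (map_poly intr p).[x].
Proof.
move=> Ox; apply: integral_horner => //; apply/integral_poly => i.
by rewrite coef_map; exact: OI_int.
Qed.

(* The constant coefficient of an integral equation of x is a multiple of x. *)
Lemma Omod_nat I : I `<=` OI M -> I <> 0 -> exists2 n, (0 < n)%N & I n%:R.
Proof.
move=> IO /Omod_neq0P[x Ix x0]; have [q q_mon qx] := IO x Ix.
have [N] := ubnP (size q); elim: N q q_mon qx => // N IH q q_mon qx sN.
have qE : q = drop_poly 1 q * 'X + (q`_0)%:P.
  rewrite -[LHS](poly_take_drop 1 q) expr1 addrC; congr (_ + _).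
  by apply/polyP => -[|i]; rewrite coef_take_poly coefC.
set r := drop_poly 1 q in qE.
have rx : (map_poly intr r).[x] * x + (q`_0)%:~R = 0.
  move: qx; rewrite /root {1}qE rmorphD rmorphM /= map_polyX map_polyC.
  by rewrite hornerD hornerMX hornerC => /eqP.
(* A vanishing constant coefficient is divided out, since x is nonzero; this leaves a monic equation
   of smaller degree. *)
have [q0|q0] := eqVneq q`_0 0.
  have rX : q = r * 'X by rewrite qE q0 addr0.
  apply: (IH r).
  - by move: q_mon; rewrite rX monicMr ?monicX.
  - move: rx; rewrite q0 addr0 => /eqP.
    by rewrite mulf_eq0 (negPf x0) orbF.
  - move: sN; rewrite {1}rX size_mulX //; apply: contraTneq q_mon => r0.
    by rewrite rX r0 mul0r monicE lead_coef0 eq_sym oner_eq0.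
have Iq : I (q`_0)%:~R.
  move/eqP: rx; rewrite addrC addr_eq0 => /eqP ->.
  by apply: OmodN; apply: OmodZ => //; apply: OI_horner; exact: IO.
exists `|(q`_0)%R|%N; first by rewrite absz_gt0.
rewrite pmulrn abszE; have [_|_] := ger0P q`_0; first exact: Iq.
by rewrite rmorphN; exact: OmodN.
Qed.

Lemma finite_indexP I : I `<=` OI M -> I <> 0 -> finite_index I.
Proof.
move=> IO I0; have [n n0 In] := Omod_nat IO I0.
have [s sn] := finite_index_nat n0; exists s => x /sn[r rs nr]; exists r => //.
by move/Oprinc_sub: In; apply.
Qed.

Lemma finite_index_pigeonhole I (f : nat -> M) : finite_index I ->
  (forall i, OI M (f i)) -> exists i j, (i < j)%N /\ I (f i - f j).
Proof.
move=> [s sI] fO.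
have /choice[r rP] : forall i, exists r, r \in s /\ I (f i - r).
  by move=> i; have [r] := sI _ (fO i); exists r.
have [i [j [ij rij]]] : exists i j, i <> j /\ r i = r j.
  apply: contrapT => h.
  pose g (i : 'I_(size s).+1) : 'I_(size s) :=
    Ordinal (n := size s) (m := index (r i) s)
      (etrans (index_mem _ _) (rP i).1).
  have g_inj : injective g.
    move=> i j /(congr1 val) /= gij; apply: contrapT => ij; apply: h.
    exists i, j; split; first by move/val_inj.
    by rewrite -(nth_index 0 (rP i).1) gij nth_index // (rP j).1.
  by have := leq_card g g_inj; rewrite !card_ord ltnn.
have Iij : I (f i - f j).
  have -> : f i - f j = (f i - r i) - (f j - r j).
    by rewrite rij opprB addrA subrK.
  by apply: OmodB; [exact: (rP i).2|exact: (rP j).2].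
have [lij|lji|/ij //] := ltngtP i j; first by exists i, j.
by exists j, i; split => //; rewrite -opprB; exact: OmodN.
Qed.

(* The powers of y act on I/aI for 0 != a in I, which has finitely many      *)
(* classes, so that y ^+ j - y ^+ i is integral for some i < j.              *)
Lemma OI_stable I y : I `<=` OI M -> I <> 0 ->
  (forall x, I x -> I (y * x)) -> OI M y.
Proof.
move=> IO /Omod_neq0P[a Ia a0] yI.
have ya n : I (y ^+ n * a).
  by elim: n => [|n IH]; rewrite ?mul1r // exprS -mulrA; exact: yI.
have [|i [j [ij [c Oc /eqP]]]] :=
    @finite_index_pigeonhole (Oprinc a) _ _ (fun n => IO _ (ya n)).
  by apply: finite_indexP; [exact: Oprinc_subO (IO _ Ia)|exact: Oprinc_neq0].
rewrite -mulrBl (inj_eq (mulIf a0)) => /eqP cE.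
apply: (@integral_root_monic _ _ _ _ ('X^j - ('X^i - c%:P))).
- rewrite monicE lead_coefDl ?lead_coefXn // size_polyXn size_polyN ltnS.
  rewrite (leq_trans (size_polyD _ _)) // geq_max size_polyXn ij size_polyN.
  by rewrite (leq_trans (size_polyC_leq1 _)) // (leq_ltn_trans _ ij).
- by rewrite /root !hornerE cE subKr subrr.
apply/integral_poly => k; rewrite !coefB !coefXn coefC.
by do 2?[apply: integral_sub; first exact: integral_nat]; case: eqP => // _;
  exact: OI0.
Qed.

End FiniteIndex.

(** * Factorization of ideals into primes *)

Section Dedekind.
Variables (M : fieldType) (hM : numfield M).
Implicit Types (I J m P : Omod M) (x y : M).

Lemma maximal_is_prime m : is_maximal_ideal m -> is_prime_ideal m.
Proof.
move=> [mO m1 mmax]; split=> // x y Ox Oy mxy;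
  apply: contrapT => /not_orP[mx my].
have : (m + Oprinc x)%R 1.
  apply: contrapT => n1; apply: mx.
  rewrite -(mmax (m + Oprinc x)) //; first by apply: Oadd_subr;
    exact: Oprinc_mem.
    exact: Oadd_subl.
  by apply/(Oadd_sub _ _ 1); split=> //; exact: Oprinc_subO.
move=> /Oadd_mem[a [_ [ma [b Ob <-] E]]]; apply: my.
rewrite -[y]mul1r E mulrDl; apply: OmodD; first exact: OmodZr.
by rewrite -mulrA; exact: OmodZ.
Qed.

(* Some 1 - x ^+ k with k > 0 lies in the prime, by the pigeonhole principle *)
(* applied to the powers of x.                                               *)
Lemma prime_is_maximal P : is_prime_ideal P -> P <> 0 -> is_maximal_ideal P.
Proof.
move=> [PO P1 Pp] P0; split=> // J PJ JO J1; apply: Omod_eq => // x Jx.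
apply: contrapT => Px; apply: J1.
have Ox := JO _ Jx.
have PX n : ~ P (x ^+ n).
  elim: n => [|n IH] //; rewrite exprS => /Pp[] //; exact: OIX.
have [i [j [ij]]] :=
  finite_index_pigeonhole (finite_indexP hM PO P0) (fun n => OIX n Ox).
have -> : x ^+ i - x ^+ j = x ^+ i * (1 - x ^+ (j - i)).
  by rewrite mulrBr mulr1 -exprD subnKC // ltnW.
case/Pp; [exact: OIX|exact: OIB (OI1 _) (OIX _ Ox)|by move/PX|].
move=> /PJ Jd; rewrite -[1](subrK (x ^+ (j - i))); apply: OmodD => //.
by rewrite -(subnSK ij) exprS; apply: OmodZr => //; exact: OIX.
Qed.

(* Noetherian induction: an ideal strictly containing I has fewer residue *)
(* classes than I.                                                        *)
Lemma ideal_ind (Q : Omod M -> Prop) :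
  (forall I, I `<=` OI M -> I <> 0 ->
    (forall J, I `<=` J -> J `<=` OI M -> J <> I -> Q J) -> Q I) ->
  forall I, I `<=` OI M -> I <> 0 -> Q I.
Proof.
move=> step I IO I0; have [s sI] := finite_indexP hM IO I0.
have [N] := ubnP (size s); elim: N I IO I0 s sI => // N IH I IO I0 s sI sN.
apply: step => // J IJ JO JI.
have [x Jx nIx] : exists2 x, J x & ~ I x.
  apply: contrapT => h; apply: JI; apply: Omod_eq => // x Jx.
  by apply: contrapT => nIx; apply: h; exists x.
have [r rs Ir] := sI x (JO _ Jx); have [r' rs' Ir'] := sI 0 (OI0 _).
have rr' : r' != r.
  apply/eqP => E; apply: nIx; rewrite -[x](subrK r); apply: OmodD => //.
  by rewrite -E -[r']opprK -[- r']sub0r; exact: OmodN.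
have Jr : J r by rewrite -[r](subKr x); apply: OmodB => //; exact: IJ.
have Jr' : J r' by rewrite -[r']opprK -[- r']sub0r; apply: OmodN; exact: IJ.
apply: (IH _ _ _ (rem r s)) => //; first exact: Omod_sub_neq0 IJ _.
  move=> z /sI[t ts /IJ Jt]; have [tr|tr] := eqVneq t r.
    exists r'; first exact: rem_mem.
    by rewrite -[z](subrK t) -addrA; apply: OmodD => //; rewrite tr;
      exact: OmodB.
  by exists t => //; exact: rem_mem.
by rewrite -ltnS size_rem // prednK //; case: (s) rs.
Qed.

Lemma maximal_above I : I `<=` OI M -> I <> 0 -> ~ I 1 ->
  exists2 m, is_maximal_ideal m & I `<=` m.
Proof.
move: I; apply: ideal_ind => I IO I0 IH I1.
have [|nm] := pselect (is_maximal_ideal I); first by exists I.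
have [J [IJ JO J1 JI]] : exists J, [/\ I `<=` J, J `<=` OI M, ~ J 1 & J <> I].
  apply: contrapT => h; apply: nm; split => // J IJ JO J1.
  by apply: contrapT => JI; apply: h; exists J.
by have [m mm Jm] := IH J IJ JO JI J1; exists m => //; exact: subset_trans Jm.
Qed.

Definition is_nzprime P := is_prime_ideal P /\ P <> 0.

Lemma prime_mul P I J : is_prime_ideal P -> I `<=` OI M -> J `<=` OI M ->
  I * J `<=` P -> I `<=` P \/ J `<=` P.
Proof.
move=> [PO P1 Pp] IO JO IJP; apply: contrapT => /not_orP[].
move=> /existsNP[x /not_implyP[Ix Px]] /existsNP[y /not_implyP[Jy Py]].
by case: (Pp x y (IO _ Ix) (JO _ Jy) (IJP _ (Omul_mem Ix Jy))).
Qed.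

Definition prime_seq (s : seq (Omod M)) := forall P, P \in s -> is_nzprime P.

Lemma prime_seq_subO s : prime_seq s -> \prod_(P <- s) P `<=` OI M.
Proof.
elim: s => [|P s IH] ps; first by rewrite big_nil.
rewrite big_cons; apply: Omul_subO; first by have [[]] := ps _ (mem_head _ _).
by apply: IH => Q Qs; apply: ps; rewrite inE Qs orbT.
Qed.

Lemma prime_sub_eq P Q : is_nzprime P -> is_nzprime Q -> P `<=` Q -> P = Q.
Proof.
move=> [Pp P0] [[QO Q1 _] _] PQ.
by have [_ _ Pm] := prime_is_maximal Pp P0; rewrite (Pm Q).
Qed.

Lemma prime_prod s P : prime_seq s -> is_nzprime P ->
  \prod_(Q <- s) Q `<=` P -> P \in s.
Proof.
move=> + pP; elim: s => [|Q s IH] ps.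
  by rewrite big_nil => /(_ _ (OI1 _)); case: pP => -[].
have ps' : prime_seq s by move=> R Rs; apply: ps; rewrite inE Rs orbT.
have pQ := ps _ (mem_head _ _).
rewrite big_cons => /(prime_mul pP.1); case.
- by case: pQ => -[].
- exact: prime_seq_subO.
- by move/(prime_sub_eq pQ pP) ->; rewrite mem_head.
- by move/(IH ps'); rewrite inE orbC => ->.
Qed.

(** If x y is in I with neither factor in I, then (I + (x)) (I + (y)) lies in I, and both factors
    are strictly larger than I. *)
Lemma contains_prime_prod I : I `<=` OI M -> I <> 0 ->
  exists2 s, prime_seq s & \prod_(P <- s) P `<=` I.
Proof.
move: I; apply: ideal_ind => I IO I0 IH.
have [I1|I1] := pselect (I 1).
  by exists [::] => //; rewrite big_nil (Omod_eq1 IO I1).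
have [pI|npI] := pselect (is_prime_ideal I).
  exists [:: I]; last by rewrite big_seq1.
  by move=> P; rewrite inE => /eqP ->.
have [x [y [Ox Oy Ixy Ix Iy]]] :
    exists x y, [/\ OI M x, OI M y, I (x * y), ~ I x & ~ I y].
  apply: contrapT => h; apply: npI; split=> // x y Ox Oy Ixy.
  by apply: contrapT => /not_orP[Ix Iy]; apply: h; exists x, y.
have IHx z : OI M z -> ~ I z ->
    exists2 s, prime_seq s & \prod_(P <- s) P `<=` I + Oprinc z.
  move=> Oz Iz; apply: IH; first exact: Oadd_subl.
    by apply/(Oadd_sub _ _ 1); split=> //; exact: Oprinc_subO.
  by move=> E; apply: Iz; rewrite -E; apply: Oadd_subr; exact: Oprinc_mem.
have [[s ps sI] [t pt tI]] := (IHx x Ox Ix, IHx y Oy Iy).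
exists (s ++ t).
  by move=> P; rewrite mem_cat => /orP[/ps|/pt].
rewrite big_cat; apply: subset_trans (OmulS sI tI) _.
rewrite mulrDl !mulrDr -OprincM; apply/Oadd_sub; split; apply/Oadd_sub; split.
- exact: Omul_subl.
- by apply: Omul_subl; exact: Oprinc_subO.
- by rewrite mulrC; apply: Omul_subl; exact: Oprinc_subO.
- exact/Oprinc_sub.
Qed.

(* Take s minimal with a product of primes inside a principal ideal (a), for *)
(* a in P; some factor is P, and the product of the others is not in (a).    *)
Lemma prime_denominator P : is_nzprime P ->
  exists2 y, ~ OI M y & forall x, P x -> OI M (y * x).
Proof.
move=> pP; have [a Pa a0] := (Omod_neq0P P).1 pP.2.
have Oa : OI M a by case: pP => -[PO _ _] _; exact: PO.
pose Q n :=
  `[< exists s,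
    [/\ prime_seq s, size s = n & \prod_(P <- s) P `<=` Oprinc a] >].
have exQ : exists n, Q n.
  have [s ps sa] := contains_prime_prod (Oprinc_subO Oa) (Oprinc_neq0 a0).
  by exists (size s); apply/asboolP; exists s.
have [n /asboolP[s [ps sn sa]] nmin] := ex_minnP exQ.
have Ps : P \in s.
  by apply: prime_prod => //; apply: subset_trans sa _; exact/Oprinc_sub.
have [b bs nb] : exists2 b, (\prod_(Q <- rem P s) Q : Omod M) b & ~ Oprinc a b.
  apply: contrapT => h; have /nmin : Q (size s).-1.
    apply/asboolP; exists (rem P s); split; last 1 first.
    - by move=> b Pb; apply: contrapT => ab; apply: h; exists b.
    - by move=> R /mem_rem; exact: ps.
    - by rewrite size_rem.
  by rewrite -sn; case: (s) Ps => //= ? ?; rewrite ltnn.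
exists (b / a) => [Oba|x Px]; first by apply: nb; exists (b / a);
  rewrite ?divfK.
have : Oprinc a (x * b).
  apply: sa; rewrite (perm_big _ (perm_to_rem Ps)) big_cons /=.
  exact: Omul_mem.
by move=> [c Oc cE]; rewrite mulrAC [b * x]mulrC -cE mulfK.
Qed.

(** With J = (O_M : P), the product P J lies between P and O_M, hence equals one of them; P J = P
    would make the nonintegral y of [prime_denominator] a multiplier of P, against [OI_stable]. The
    last two conjuncts serve to show that multiplication by J strictly enlarges an ideal. *)
Lemma prime_invertible P : is_nzprime P ->
  exists J, [/\ fractional J, P * J = 1, J 1 & exists2 y, J y & ~ OI M y].
Proof.
move=> pP; have [y nOy yP] := prime_denominator pP.
have [[PO P1 Pp] P0] := pP; have [_ _ Pm] := prime_is_maximal pP.1 P0.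
pose J := Ocolon 1 P; have J1 : J 1 by move=> x Px; rewrite mul1r; exact: PO.
have Jy : J y by [].
have PJO : P * J `<=` OI M.
  by apply/(Omul_sub _ _ 1) => x z Px Jz; rewrite mulrC; exact: Jz.
exists J; split=> //; last by exists y.
  split; first by apply/Omod_neq0P; exists 1 => //; exact: oner_neq0.
  have [a Pa a0] := (Omod_neq0P P).1 P0; exists a; split=> //; first exact: PO.
  by move=> x /(_ a Pa); rewrite mulrC.
apply: Omod_eq1 => //; apply: contrapT => nPJ1; apply: nOy.
have PJ : P `<=` P * J by move=> x Px; rewrite -[x]mulr1; exact: Omul_mem.
apply: (OI_stable hM PO P0) => x Px;
  rewrite -[X in Omod_set X](Pm (P * J)) // mulrC.
exact: Omul_mem.
Qed.

(** For a maximal P containing I, the ideal I P^-1 is integral and strictly contains I: otherwise a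
    nonintegral element of P^-1 would stabilize I. The induction hypothesis applies to it. *)
Lemma prime_factorization I : I `<=` OI M -> I <> 0 ->
  exists2 s, prime_seq s & I = \prod_(P <- s) P.
Proof.
move: I; apply: ideal_ind => I IO I0 IH.
have [I1|I1] := pselect (I 1).
  by exists [::] => //; rewrite big_nil (Omod_eq1 IO I1).
have [P Pm IP] := maximal_above IO I0 I1.
have pP : is_nzprime P by split;
  [exact: maximal_is_prime|exact: Omod_sub_neq0 IP _].
have [J [_ PJ J1 [y Jy nOy]]] := prime_invertible pP.
have IJ : I `<=` I * J by move=> x Ix; rewrite -[x]mulr1; exact: Omul_mem.
have [||s ps sE] := IH (I * J) IJ.
- by rewrite -[OI M]/(Omod_set 1) -PJ; exact: OmulS.
- move=> E; apply: nOy; apply: (OI_stable hM IO I0) => x Ix.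
  by rewrite -E mulrC; exact: Omul_mem.
exists (P :: s); first by move=> Q; rewrite inE => /orP[/eqP ->|/ps].
by rewrite big_cons -sE mulrCA PJ mulr1.
Qed.

Lemma prime_prod_invertible s : prime_seq s ->
  exists2 J, fractional J & \prod_(P <- s) P * J = 1.
Proof.
elim: s => [|P s IH] ps.
  by exists 1; [exact: fractional1|rewrite big_nil mulr1].
have [J [fJ PJ _ _]] := prime_invertible (ps _ (mem_head _ _)).
have [|J' fJ' sJ'] := IH; first by move=> Q Qs; apply: ps; rewrite inE Qs orbT.
by exists (J * J'); [exact: fractionalM|rewrite big_cons mulrACA PJ sJ' mulr1].
Qed.

Lemma fractional_invertible I : fractional I ->
  exists2 J, fractional J & I * J = 1.
Proof.
move=> [I0 [d [d0 Od dI]]].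
have fd := integral_fractional (Oprinc_subO Od) (Oprinc_neq0 d0).
have [|| s ps sE] := @prime_factorization (Oprinc d * I).
- by apply/(Omul_sub _ _ 1) => _ x [a Oa <-] Ix; rewrite -mulrA;
  exact: OIM (dI _ Ix).
- exact: Omul_neq0 (fd.1) I0.
have [J fJ J1] := prime_prod_invertible ps.
by exists (Oprinc d * J); [exact: fractionalM|rewrite mulrCA mulrA sE].
Qed.

End Dedekind.

(** * Valuations of fractional ideals *)

Section Ord.
Variables (M : fieldType) (hM : numfield M).
Implicit Types (I : Omod M) (i j a b p q : fracideal M) (s : seq (fracideal M)).

(** Made total by the default 0, which is the unit ideal in additive notation; it is meaningful on
    fractional ideals, by [frac_ofK]. *)
Definition frac_of I : fracideal M := xget 0 [set i | fracideal_ideal i = I].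

Lemma fracidealP i : fractional (fracideal_ideal i).
Proof. by case: i => p pP; case/asboolP: (pP). Qed.

Lemma frac_ofK I : fractional I -> fracideal_ideal (frac_of I) = I.
Proof.
move=> fI; have [J fJ IJ] := fractional_invertible hM fI.
have P : fracideal_pred (I, J) by exact/asboolP.
by rewrite /frac_of; case: xgetP => [i _ //|/(_ (Sub (I, J) P)) []].
Qed.

Lemma fracideal_idealK i : frac_of (fracideal_ideal i) = i.
Proof. by apply: fracideal_inj; apply: frac_ofK; exact: fracidealP. Qed.

Definition integral_frac i := fracideal_ideal i `<=` OI M.

Lemma fracideal_ideal0 :
  fracideal_ideal (0 : fracideal M) = 1. Proof. by []. Qed.

Lemma integral_frac0 : integral_frac 0. Proof. by []. Qed.

Lemma integral_fracD i j :
  integral_frac i -> integral_frac j -> integral_frac (i + j).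
Proof. exact: Omul_subO. Qed.

(** To divide is to contain. *)
Lemma integral_subB i j :
  integral_frac (i - j) <-> fracideal_ideal i `<=` fracideal_ideal j.
Proof.
have mono (k l h : fracideal M) : fracideal_ideal k `<=` fracideal_ideal l ->
    fracideal_ideal (k + h) `<=` fracideal_ideal (l + h).
  by move=> kl; exact: OmulS.
split=> [ij|/(mono _ _ (- j))]; last by rewrite subrr.
by have := mono _ 0 j ij; rewrite subrK add0r.
Qed.

Lemma fracideal_ideal_sum s :
  fracideal_ideal (\sum_(p <- s) p) = \prod_(p <- s) fracideal_ideal p.
Proof. exact: (big_morph _ (@fracideal_idealD M) fracideal_ideal0). Qed.

Lemma fracideal_idealMn i n : fracideal_ideal (i *+ n) = fracideal_ideal i ^+ n.
Proof.
by elim: n => [|n IH]; rewrite ?mulr0n // mulrS exprS fracideal_idealD IH.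
Qed.

Definition primef p := is_nzprime (fracideal_ideal p).

Lemma primef_integral p : primef p -> integral_frac p.
Proof. by case=> -[]. Qed.

Lemma primef_frac_of I : is_nzprime I -> primef (frac_of I).
Proof.
move=> pI; rewrite /primef frac_ofK //; case: pI => -[IO _ _] I0.
exact: integral_fractional.
Qed.

Lemma integral_sum_prime i : integral_frac i ->
  exists2 s, (forall p, p \in s -> primef p) & i = \sum_(p <- s) p.
Proof.
move=> ii; have [s ps sE] := prime_factorization hM ii (fracidealP i).1.
exists [seq frac_of P | P <- s].
  by move=> _ /mapP[P /ps pP ->]; exact: primef_frac_of.
apply: fracideal_inj; rewrite fracideal_ideal_sum big_map sE.
apply: eq_big_seq => P /ps[[PO _ _] P0]; rewrite frac_ofK //.
exact: integral_fractional.
Qed.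

Lemma frac_integralB i :
  exists a b, [/\ integral_frac a, integral_frac b & i = a - b].
Proof.
have [_ [d [d0 Od dI]]] := fracidealP i;
  have fd := integral_fractional (Oprinc_subO Od) (Oprinc_neq0 d0).
exists (i + frac_of (Oprinc d)), (frac_of (Oprinc d)); split;
  last by rewrite addrK.
  rewrite /integral_frac fracideal_idealD (frac_ofK fd); apply/(Omul_sub _ _ 1).
  by move=> x _ Ix [c Oc <-]; rewrite mulrCA [x * d]mulrC; apply: OIM => //;
    exact: dI.
by rewrite /integral_frac (frac_ofK fd); exact: Oprinc_subO.
Qed.

Definition coprimef p i :=
  integral_frac i /\ ~ (fracideal_ideal i `<=` fracideal_ideal p).

Lemma coprimefD p i j : primef p -> coprimef p i -> coprimef p j ->
  coprimef p (i + j).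
Proof.
move=> pp [ii ip] [jj jp]; split; first exact: integral_fracD.
by rewrite fracideal_idealD => /(prime_mul pp.1 ii jj)[].
Qed.

Lemma coprimef0 p : primef p -> coprimef p 0.
Proof. by move=> [[_ p1 _] _]; split=> [//|/(_ _ (OI1 _))]. Qed.

Lemma coprimef_prime p q : primef p -> primef q -> p != q -> coprimef p q.
Proof.
move=> pp pq npq; split; first exact: primef_integral.
move/(prime_sub_eq hM pq pp)/fracideal_inj => E.
by rewrite E eqxx in npq.
Qed.

(* The p-adic valuation: in multiplicative notation, i = p ^ k a / b with a *)
(* and b prime to p.                                                        *)
Definition ord p i : int := xget 0 [set k : int |
  exists a b, [/\ coprimef p a, coprimef p b & i = p *~ k + (a - b)]].

(** For k < l, clearing denominators gives p^(l-k) a' b = a b', where the left side lies in p and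
    the right side is prime to p. *)
Lemma ord_uniq p k l a b a' b' : primef p ->
  coprimef p a -> coprimef p b -> coprimef p a' -> coprimef p b' ->
  p *~ k + (a - b) = p *~ l + (a' - b') -> k = l.
Proof.
move=> pp; wlog : k l a b a' b' / (k < l)%R => [W|kl] ca cb ca' cb' E.
  have [kl|lk|//] := ltgtP k l; first exact: (W _ _ _ _ _ _ kl ca cb ca' cb' E).
  by apply/esym; apply: (W _ _ _ _ _ _ lk ca' cb' ca cb (esym E)).
have [n lkE] : exists n, l - k = n.+1%:Z.
  have : 0 < l - k by rewrite subr_gt0.
  by case: (l - k) => [[|n]|n] //; exists n.
have {}E : p *+ n.+1 + (a' + b) = a + b'.
  have -> : p *+ n.+1 = (a - b) - (a' - b').
    apply: (addIr (a' - b')); rewrite subrK pmulrn -lkE mulrzBr addrAC -E.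
    by rewrite [_ + (a - b)]addrC addrK.
  by rewrite opprB (addrACA a) -opprD [a' + b]addrC subrK.
have : coprimef p (a + b') by exact: coprimefD.
case=> _; case; rewrite -E mulrS -!addrA fracideal_idealD; apply: Omul_subl.
have pi := primef_integral pp.
apply: integral_fracD; last exact: integral_fracD ca'.1 cb.1.
by elim: n {lkE E} => [|n IH] //; rewrite mulrS; exact: integral_fracD.
Qed.

Lemma ord_eq p k a b : primef p -> coprimef p a -> coprimef p b ->
  ord p (p *~ k + (a - b)) = k.
Proof.
move=> pp ca cb; rewrite /ord;
  case: xgetP => [l _ [a' [b' [ca' cb' E]]]|/(_ k) []].
  by apply/esym; apply: (ord_uniq pp ca cb ca' cb' E).
by exists a, b.
Qed.

(** The ideals of this form are a subgroup containing every prime, and the primes generate all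
    fractional ideals. *)
Lemma ordP p i : primef p ->
  exists a b, [/\ coprimef p a, coprimef p b & i = p *~ ord p i + (a - b)].
Proof.
move=> pp; have c0 := coprimef0 pp.
suff [k [a [b [ca cb E]]]] : exists k a b,
    [/\ coprimef p a, coprimef p b & i = p *~ k + (a - b)].
  by exists a, b; split=> //; rewrite {2}E ord_eq.
pose H i :=
  exists k a b, [/\ coprimef p a, coprimef p b & i = p *~ k + (a - b)].
have HB j l : H j -> H l -> H (j - l).
  move=> [k [a [b [ca cb ->]]]] [k' [a' [b' [ca' cb' ->]]]].
  exists (k - k'), (a + b'), (b + a'); split; try exact: coprimefD.
  by rewrite mulrzBr opprD addrACA opprB (addrACA a) -opprD.
have H0 : H 0 by exists 0, 0, 0; rewrite mulr0z subr0 addr0.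
have HD j l : H j -> H l -> H (j + l).
  by move=> Hj Hl; rewrite -[l]opprK -[- l]sub0r; do 2!apply: (HB) => //.
have Hp q : primef q -> H q.
  move=> pq; have [<-|npq] := eqVneq p q.
    by exists 1, 0, 0; rewrite subr0 addr0 mulr1z.
  by exists 0, q, 0; split=> //;
    [exact: coprimef_prime|rewrite mulr0z add0r subr0].
have [a [b [/integral_sum_prime[s ps ->] /integral_sum_prime[t pt ->] ->]]] :=
  frac_integralB i.
apply: HB.
  by rewrite big_seq; elim/big_ind: _ => // q /ps; exact: Hp.
by rewrite big_seq; elim/big_ind: _ => // q /pt; exact: Hp.
Qed.

Lemma ordB p : primef p -> {morph ord p : i j / i - j}.
Proof.
move=> pp i j; have [a [b [ca cb iE]]] := ordP i pp.
have [a' [b' [ca' cb' jE]]] := ordP j pp.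
have -> : i - j = p *~ (ord p i - ord p j) + ((a + b') - (b + a')).
  by rewrite {1}iE {1}jE mulrzBr opprD addrACA opprB (addrACA a) -opprD.
by rewrite ord_eq //; exact: coprimefD.
Qed.

Lemma ord0 p : primef p -> ord p 0 = 0.
Proof. by move=> pp; have := ordB pp 0 0; rewrite !subrr. Qed.

Lemma ordN p i : primef p -> ord p (- i) = - ord p i.
Proof. by move=> pp; rewrite -[- i]sub0r ordB // ord0 // sub0r. Qed.

Lemma ordD p : primef p -> {morph ord p : i j / i + j}.
Proof. by move=> pp i j; rewrite /= -{1}[j]opprK ordB // ordN // opprK. Qed.

Lemma ord_sum (T : Type) p (r : seq T) (F : T -> fracideal M) : primef p ->
  ord p (\sum_(t <- r) F t) = \sum_(t <- r) ord p (F t).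
Proof. by move=> pp; apply: big_morph; [exact: ordD|exact: ord0]. Qed.

Lemma ordMz p i k : primef p -> ord p (i *~ k) = ord p i * k.
Proof.
move=> pp; have ordMn n : ord p (i *+ n) = ord p i * n%:Z.
  by elim: n => [|n IH];
    rewrite ?mulr0 ?ord0 // mulrS ordD // IH intS mulrDr mulr1.
by case: k => n; rewrite ?NegzE ?mulrNz ?ordN // -pmulrn ordMn ?mulrN.
Qed.

Lemma ord_prime p q : primef p -> primef q -> ord p q = (p == q)%:Z.
Proof.
move=> pp pq; have c0 := coprimef0 pp; have [<-|npq] := eqVneq p q.
  by rewrite -[X in ord _ X]addr0 -[X in X + _]mulr1z -[X in _ + X](subrr 0) ord_eq.
rewrite -[X in ord _ X](subr0 q) -[X in ord _ X]add0r -(mulr0z p) ord_eq //.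
exact: coprimef_prime.
Qed.

Lemma ord_ge0 p i : primef p -> integral_frac i -> 0 <= ord p i.
Proof.
move=> pp /integral_sum_prime[s ps ->]; rewrite ord_sum // big_seq.
by apply: sumr_ge0 => q /ps pq; rewrite ord_prime //; case: eqP.
Qed.

(** The list collects the primes occurring in a numerator and a denominator of i; the formula holds
    for each of these primes and is stable under differences. *)
Lemma ord_decomposition i : exists s, [/\ uniq s, forall p, p \in s -> primef p,
  forall p, primef p -> p \notin s -> ord p i = 0 &
    i = \sum_(p <- s) p *~ ord p i].
Proof.
have [a [b [/integral_sum_prime[s ps ->] /integral_sum_prime[t pt ->] {i}->]]] := frac_integralB i.
pose u := undup (s ++ t); have pu p : p \in u -> primef p.
  by rewrite mem_undup mem_cat => /orP[/ps|/pt].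
have uu : uniq u by exact: undup_uniq.
exists u; split=> //.
  move=> p pp; rewrite mem_undup mem_cat negb_or => /andP[ns nt].
  rewrite ordB // !ord_sum // !big_seq !big1 ?subrr // => q qs;
    rewrite ord_prime //.
  - by case: eqP nt => // ->; rewrite qs.
  - exact: pt.
  - by case: eqP ns => // ->; rewrite qs.
  - exact: ps.
pose H i := i = \sum_(p <- u) p *~ ord p i.
have HB j l : H j -> H l -> H (j - l).
  rewrite /H => {1}-> {1}->; rewrite -sumrB; apply: eq_big_seq => p /pu pp.
  by rewrite ordB // mulrzBr.
have H0 : H 0.
  by rewrite /H big_seq big1 // => p /pu pp; rewrite ord0 ?mulr0z.
have HD j l : H j -> H l -> H (j + l).
  by move=> Hj Hl; rewrite -[l]opprK -[- l]sub0r; do 2!apply: (HB) => //.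
have Hu q : q \in u -> H q.
  move=> qu; have pq := pu _ qu.
  rewrite /H (bigD1_seq q) //= (ord_prime pq pq) eqxx mulr1z.
  rewrite big_seq_cond big1 ?addr0 // => p /andP[/pu pp npq].
  by rewrite ord_prime // (negPf npq) mulr0z.
apply: HB; rewrite big_seq; elim/big_ind: _ => // q qs; apply: Hu;
  by rewrite mem_undup mem_cat qs ?orbT.
Qed.

Lemma ord_inj i j : (forall p, primef p -> ord p i = ord p j) -> i = j.
Proof.
move=> ij; apply/eqP; rewrite -subr_eq0; apply/eqP.
have [s [_ ps _ ->]] := ord_decomposition (i - j).
by rewrite big_seq big1 // => p /ps pp; rewrite ordB // ij // subrr mulr0z.
Qed.

Lemma integral_fracP i : integral_frac i <-> forall p, primef p -> 0 <= ord p i.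
Proof.
split=> [ii p pp|ip]; first exact: ord_ge0.
have [s [_ ps _ ->]] := ord_decomposition i; rewrite big_seq.
elim/big_ind: _ => [||p /ps pp]; [exact: integral_frac0|exact: integral_fracD|].
move: (ip p pp); case: (ord p i) => // n _; rewrite -pmulrn.
by elim: n => [|n IH] //; rewrite mulrS; apply: integral_fracD => //;
  exact: primef_integral.
Qed.

Lemma ord_subX p i n : primef p -> integral_frac i ->
  fracideal_ideal i `<=` fracideal_ideal p ^+ n <-> n%:Z <= ord p i.
Proof.
move=> pp ii; rewrite -fracideal_idealMn -integral_subB integral_fracP.
have E q : primef q -> ord q (i - p *+ n) = ord q i - (q == p)%:Z * n%:Z.
  by move=> pq; rewrite ordB // pmulrn ordMz // (ord_prime pq pp).
split=> [/(_ p pp)|ni q pq]; first by rewrite E // eqxx mul1r subr_ge0.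
rewrite E //; have [->|_] := eqVneq q p; first by rewrite mul1r subr_ge0.
by rewrite mul0r subr0; exact: ord_ge0.
Qed.

Lemma ord_sub p i : primef p -> integral_frac i ->
  fracideal_ideal i `<=` fracideal_ideal p <-> 0 < ord p i.
Proof. by move=> pp ii; rewrite -[fracideal_ideal p]expr1 ord_subX. Qed.

End Ord.

(** * Extension of ideals and the Galois action *)

Section ExtendIdeals.
Variables (K : fieldType) (L : fieldExtType K).
Implicit Types (a : K) (I : Omod K) (J : Omod L) (i : fracideal K).

Lemma OI_in_algE a : OI L a%:A <-> OI K a.
Proof.
split=> [|/(@OI_in_alg K L) //] [p p_mon pa]; exists p => //; move: pa.
have -> : map_poly (intr : int -> L) p = map_poly (in_alg L) (map_poly intr p).
  by rewrite -map_poly_comp; apply: eq_map_poly => n; exact/esym/rmorph_int.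
by rewrite -[a%:A]/(in_alg L a) fmorph_root.
Qed.

Lemma extend_subO I : I `<=` OI K -> extend L I `<=` OI L.
Proof. by move=> IO; apply/(extend_sub _ 1) => a /IO Oa; exact: OI_in_alg. Qed.

Lemma contract_subO J : J `<=` OI L -> contract J `<=` OI K.
Proof. by move=> JO a /JO /OI_in_algE. Qed.

Lemma extend_neq0 I : I <> 0 -> extend L I <> 0.
Proof.
move=> /Omod_neq0P[a Ia a0]; apply/Omod_neq0P; exists a%:A;
  first exact: extend_mem.
by rewrite alg_scalar_eq0.
Qed.

Lemma fracideal_ideal_extend i :
  fracideal_ideal (extend_fracideal L i) = extend L (fracideal_ideal i).
Proof. by []. Qed.

(** An element of K is integral as soon as it is integral in L, so I O_L = O_L forces I to be
    integral; the same applies to I^-1. *)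
Lemma extend_fracideal_inj : injective (@extend_fracideal K L).
Proof.
have sub i : extend_fracideal L i = 0 -> integral_frac i.
  move=> i0 a ia; apply/OI_in_algE.
  by have : extend L (fracideal_ideal i) a%:A;
    [exact: extend_mem|rewrite -fracideal_ideal_extend i0].
apply: (raddf_inj (f := @extend_fracideal K L)) => i i0.
apply: fracideal_inj; apply: Omod_eq; first exact: sub.
by apply/integral_subB; rewrite sub0r; apply: sub; rewrite raddfN i0 oppr0.
Qed.

Lemma contract_prime I J : is_maximal_ideal I -> is_prime_ideal J ->
  extend L I `<=` J -> contract J = I.
Proof.
move=> [_ _ Im] [JO J1 _] /extend_sub IJ; apply: Im => //;
  first exact: contract_subO.
by rewrite /= scale1r.
Qed.

End ExtendIdeals.

Section GaloisAction.
Variables (K : fieldType) (L : splittingFieldType K) (hL : numfield L).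
Local Notation G := (gal_of {:L}).
Implicit Types (s t : G) (I J : Omod L) (i j p q : fracideal L) (x y : L).

Lemma galMx s t x : (s * t)%g x = t (s x).
Proof. by rewrite galM ?memvf. Qed.

Lemma galKx s x : (s^-1)%g (s x) = x.
Proof. by rewrite -galMx mulgV gal_id. Qed.

Lemma galVKx s x : s ((s^-1)%g x) = x.
Proof. by rewrite -galMx mulVg gal_id. Qed.

Lemma gal_alg s (a : K) : s a%:A = a%:A.
Proof. by rewrite linearZ /= rmorph1. Qed.

Lemma mem_gal1 s : s \in 'Gal({:L} / 1)%g.
Proof. by rewrite gal_kHom ?sub1v // k1HomE ahomWin. Qed.

Lemma gal_fixed_alg x :
  galois 1 {:L} -> (forall s, s x = x) -> exists a : K, x = a%:A.
Proof.
move=> /galois_fixedField fixE xs.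
have : x \in fixedField 'Gal({:L} / 1)%g by apply/fixedFieldP => [|s _];
  rewrite ?memvf.
by rewrite fixE => /vlineP.
Qed.

Lemma OI_gal s x : OI L x -> OI L (s x).
Proof.
case=> p p_mon px0; exists p => //.
have -> : map_poly intr p = map_poly s (map_poly (intr : int -> L) p).
  by rewrite -map_poly_comp; apply: eq_map_poly => n; exact/esym/rmorph_int.
by rewrite fmorph_root.
Qed.

Lemma gal_pre_closed s I : Omod_closed [set x | I (s x)].
Proof.
split=> [|x y Ix Iy|a x Oa Ix] /=; first by rewrite rmorph0; exact: Omod0.
  by rewrite rmorphD; exact: OmodD.
by rewrite rmorphM; apply: OmodZ => //; exact: OI_gal.
Qed.

(* The conjugate of I under s^-1, so this is a contravariant action. *)
Definition gal_pre s I : Omod L := MkOmod (gal_pre_closed s I).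

Lemma gal_preM s t I : gal_pre s (gal_pre t I) = gal_pre (s * t)%g I.
Proof. by apply: Omod_eq => x /=; rewrite galMx. Qed.

Lemma gal_pre1 I : gal_pre 1%g I = I.
Proof. by apply: Omod_eq => x /=; rewrite gal_id. Qed.

Lemma gal_preVK s I : gal_pre s (gal_pre s^-1%g I) = I.
Proof. by rewrite gal_preM mulgV gal_pre1. Qed.

Lemma gal_preK s I : gal_pre s^-1%g (gal_pre s I) = I.
Proof. by rewrite gal_preM mulVg gal_pre1. Qed.

Lemma gal_preS s I J : I `<=` J -> gal_pre s I `<=` gal_pre s J.
Proof. by move=> IJ x /IJ. Qed.

Lemma gal_pre_subO s I : I `<=` OI L -> gal_pre s I `<=` OI L.
Proof. by move=> IO x /IO /(OI_gal s^-1%g); rewrite galKx. Qed.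

Lemma gal_pre_mul s I J : gal_pre s (I * J) = gal_pre s I * gal_pre s J.
Proof.
have sub t I' J' : gal_pre t I' * gal_pre t J' `<=` gal_pre t (I' * J').
  by apply/Omul_sub => x y Ix Jy /=; rewrite rmorphM; exact: Omul_mem.
apply: Omod_eq; last exact: sub.
have := @sub s^-1%g (gal_pre s I) (gal_pre s J);
  rewrite !gal_preK => /(@gal_preS s _ _).
by rewrite gal_preVK.
Qed.

Lemma gal_pre_princ s x : gal_pre s (Oprinc (s x)) = Oprinc x.
Proof.
apply: Omod_eq; last by apply/Oprinc_sub; exact: Oprinc_mem.
move=> y [a Oa E]; exists ((s^-1)%g a); first exact: OI_gal.
by have := congr1 (s^-1)%g E; rewrite rmorphM /= !galKx.
Qed.

Lemma gal_pre_eq I :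
  (forall s, I `<=` gal_pre s I) -> forall s, gal_pre s I = I.
Proof.
move=> sub s; apply: Omod_eq => //.
by rewrite -[X in _ `<=` Omod_set X](gal_preVK s); apply: gal_preS; exact: sub.
Qed.

Lemma gal_pre_extend s (I : Omod K) : gal_pre s (extend L I) = extend L I.
Proof.
apply: gal_pre_eq => {}s; apply/extend_sub => a Ia /=.
by rewrite gal_alg; exact: extend_mem.
Qed.

Lemma gal_pre_neq0 s I : I <> 0 -> gal_pre s I <> 0.
Proof.
move=> /Omod_neq0P[x Ix x0]; apply/Omod_neq0P; exists ((s^-1)%g x).
  by rewrite /= galVKx.
by rewrite fmorph_eq0.
Qed.

Lemma gal_pre_fractional s I : fractional I -> fractional (gal_pre s I).
Proof.
move=> [I0 [d [d0 Od dI]]]; split; first exact: gal_pre_neq0.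
exists ((s^-1)%g d); split; [by rewrite fmorph_eq0|exact: OI_gal|].
by move=> x /dI /(OI_gal s^-1%g); rewrite rmorphM /= galKx.
Qed.

Lemma gal_pre_prime s I : is_prime_ideal I -> is_prime_ideal (gal_pre s I).
Proof.
move=> [IO I1 Ip]; split=> [||x y Ox Oy /=]; first exact: gal_pre_subO.
  by rewrite /= rmorph1.
by rewrite rmorphM => /Ip; apply; exact: OI_gal.
Qed.

Definition gal_frac s i :
  fracideal L := frac_of (gal_pre s (fracideal_ideal i)).

Lemma fracideal_ideal_gal s i :
  fracideal_ideal (gal_frac s i) = gal_pre s (fracideal_ideal i).
Proof. by apply: frac_ofK => //; apply: gal_pre_fractional;
  exact: fracidealP. Qed.

Lemma gal_frac_is_additive s : zmod_morphism (gal_frac s).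
Proof.
move=> i j; apply: (addIr (gal_frac s j)); rewrite subrK; apply: fracideal_inj.
rewrite fracideal_idealD !fracideal_ideal_gal -gal_pre_mul -fracideal_idealD.
by rewrite subrK.
Qed.

Lemma primef_gal s p : primef p -> primef (gal_frac s p).
Proof.
move=> [pp p0]; rewrite /primef fracideal_ideal_gal.
by split; [exact: gal_pre_prime|exact: gal_pre_neq0].
Qed.

Lemma coprimef_gal s p i :
  coprimef p i -> coprimef (gal_frac s p) (gal_frac s i).
Proof.
move=> [ii ip]; split; rewrite /integral_frac !fracideal_ideal_gal;
  first exact: gal_pre_subO.
by move=> /(@gal_preS s^-1%g _ _); rewrite !gal_preK.
Qed.

Lemma ord_gal s p i : primef p -> ord (gal_frac s p) (gal_frac s i) = ord p i.
Proof.
move=> pp; have [a [b [ca cb {1}->]]] := ordP hL i pp.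
pose f := GRing.isZmodMorphism.Build _ _ (gal_frac s) (gal_frac_is_additive s).
pose g : {additive fracideal L -> fracideal L} := HB.pack (gal_frac s) f.
rewrite -[gal_frac s (_ + _)]/(g _) raddfD raddfMz raddfB.
by apply: ord_eq => //;
  [exact: primef_gal|exact: coprimef_gal|exact: coprimef_gal].
Qed.

Definition gal_invariant i :=
  forall s, gal_pre s (fracideal_ideal i) = fracideal_ideal i.

Lemma gal_invariantE i : gal_invariant i <-> forall s, gal_frac s i = i.
Proof.
split=> inv s; last by rewrite -fracideal_ideal_gal inv.
by apply: fracideal_inj; rewrite fracideal_ideal_gal inv.
Qed.

Lemma gal_invariantB i j :
  gal_invariant i -> gal_invariant j -> gal_invariant (i - j).
Proof.
move=> /gal_invariantE Hi /gal_invariantE Hj; apply/gal_invariantE => s.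
by rewrite gal_frac_is_additive Hi Hj.
Qed.

Lemma gal_invariant_extend (i : fracideal K) :
  gal_invariant (extend_fracideal L i).
Proof. by move=> s; rewrite fracideal_ideal_extend gal_pre_extend. Qed.

Lemma ord_invariant s p i : primef p -> gal_invariant i ->
  ord (gal_frac s p) i = ord p i.
Proof. by move=> pp /gal_invariantE Hi; rewrite -[i in LHS](Hi s) ord_gal. Qed.

End GaloisAction.

(** * Primes of L above a prime of K, their conjugacy and their norms *)

Section PrimesAbove.
Variables (K : fieldType) (L : splittingFieldType K).
Variables (hK : numfield K) (hL : numfield L) (galLK : galois 1 {:L}).
Local Notation G := (gal_of {:L}).
Local Notation norm := (galNorm 1 {:L}).
Implicit Types (P Q : fracideal K) (p q i j : fracideal L) (m : Omod L).

Definition above P p :=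
  [/\ primef P, primef p & extend L (fracideal_ideal P) `<=` fracideal_ideal p].

Lemma above_contract P p :
  above P p -> contract (fracideal_ideal p) = fracideal_ideal P.
Proof.
move=> [pP pp Pp]; apply: contract_prime => //; last by case: pp.
by apply: prime_is_maximal => //; case: pP.
Qed.

Lemma above_uniq P Q p : above P p -> above Q p -> P = Q.
Proof. by move=> /above_contract E /above_contract F; apply: fracideal_inj;
  rewrite -E. Qed.

(** P O_L is proper because extension is injective on fractional ideals, so some maximal ideal
    contains it. *)
Lemma above_ex P : primef P -> exists p, above P p.
Proof.
move=> pP; have [[PO P1 _] P0] := pP.
have [m mm Pm] :
  exists2 m, is_maximal_ideal m & extend L (fracideal_ideal P) `<=` m.
  apply: maximal_above => //; [exact: extend_subO|exact: extend_neq0|] => E1.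
  apply: P1; suff -> : P = 0 by exact: OI1.
  apply: (@extend_fracideal_inj _ L); rewrite raddf0; apply: fracideal_inj.
  by rewrite fracideal_ideal_extend (Omod_eq1 (extend_subO PO) E1).
have m0 : m <> 0 by apply: Omod_sub_neq0 Pm _; exact: extend_neq0.
have fm : fractional m by apply: integral_fractional => //; case: mm.
exists (frac_of m); split=> //; last by rewrite frac_ofK.
by apply: primef_frac_of => //; split=> //; exact: maximal_is_prime.
Qed.

Lemma below_ex p : primef p -> exists P, above P p.
Proof.
move=> pp; have [[pO p1 pprime] p0] := pp.
pose P := contract (fracideal_ideal p).
have P0 : P <> 0.
  have [n n0 pn] := Omod_nat pO p0; apply/Omod_neq0P; exists n%:R.
    by rewrite /= scaler_nat.
  exact: numfield_nat_neq0 hK n n0.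
have pP : is_nzprime P.
  split=> //; split=> [||a b Oa Ob]; first exact: contract_subO.
    by rewrite /= scale1r.
  by rewrite /= alg_scalarM => /pprime; apply; exact: OI_in_alg.
have PP : fracideal_ideal (frac_of P) = P.
  by apply: frac_ofK => //; apply: integral_fractional; case: pP => -[].
exists (frac_of P); split=> //; first exact: primef_frac_of.
by rewrite PP; apply/extend_sub.
Qed.

Lemma above_gal s P p : above P p -> above P (gal_frac s p).
Proof.
move=> [pP pp Pp]; split=> //; first exact: primef_gal.
by rewrite fracideal_ideal_gal // -(gal_pre_extend s); exact: gal_preS.
Qed.

Lemma norm_alg x : exists a : K, norm x = a%:A.
Proof. by have /vlineP := mem_galNorm galLK (memvf x). Qed.

Lemma norm_mem m x : m `<=` OI L -> m x -> m (norm x).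
Proof.
move=> mO mx; rewrite /galNorm (bigD1 1%g) ?group1 //= gal_id;
  apply: OmodZr => //.
by elim/big_ind: _ => [||s _]; [exact: OI1|exact: OIM|apply/OI_gal/mO].
Qed.

Lemma prime_prod_mem m (T : finType) (A : pred T) (F : T -> L) :
  is_prime_ideal m ->
  (forall t, OI L (F t)) -> m (\prod_(t | A t) F t) -> exists t, m (F t).
Proof.
move=> [_ m1 mp] FO mF; apply: contrapT => h.
suff [] : OI L (\prod_(t | A t) F t) /\ ~ m (\prod_(t | A t) F t) by [].
elim/big_ind: _ => [|x y [Ox nx] [Oy ny]|t _].
- by split=> //; exact: OI1.
- by split; [exact: OIM|case/mp].
- by split=> // mt; apply: h; exists t.
Qed.

(* If q is no conjugate of p, then by the Chinese remainder theorem some x in *)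
(* q is 1 modulo each conjugate of p; its norm lies in P, hence in p.        *)
Lemma above_transitive P p q :
  above P p -> above P q -> exists s : G, q = gal_frac s p.
Proof.
move=> Pp Pq; have [pP pp PLp] := Pp; have [_ pq _] := Pq.
apply: contrapT => h.
have /choice[y yP] : forall s : G, exists y, gal_pre s (fracideal_ideal p) y /\
    ~ fracideal_ideal q y.
  move=> s; apply: contrapT => hs; apply: h; exists s; apply/esym.
  apply: fracideal_inj; apply: (prime_sub_eq hL (primef_gal hL s pp) pq).
  rewrite fracideal_ideal_gal // => y py; apply: contrapT => qy.
  by apply: hs; exists y.
have yO s : OI L (y s).
  by have [+ _] := yP s; apply: gal_pre_subO; exact: primef_integral.
(* [z] lies in every conjugate of p but not in q, so q + (z) is the unit ideal and some x = 1 - a z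
   lies in q. *)
pose z := \prod_s y s.
have zO : OI L z by rewrite /z; elim/big_ind: _ => //; [exact: OI1|exact: OIM].
have nqz : ~ fracideal_ideal q z by move/(prime_prod_mem pq.1 yO) => [s];
  exact: (yP s).2.
have pz (s : G) : fracideal_ideal p (s z).
  have : gal_pre s (fracideal_ideal p) z by rewrite /z (bigD1 s) //;
    apply: OmodZr;
    [elim/big_ind: _ => //; [exact: OI1|exact: OIM]|exact: (yP s).1].
  by [].
have [qO _ qmax] := prime_is_maximal hL pq.1 pq.2.
have : (fracideal_ideal q + Oprinc z)%R 1.
  apply: contrapT => n1; apply: nqz.
  rewrite -(qmax (fracideal_ideal q + Oprinc z)) //.
  - by apply: Oadd_subr; exact: Oprinc_mem.
  - exact: Oadd_subl.
  - by apply/(Oadd_sub _ _ 1); split=> //; exact: Oprinc_subO.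
move=> /Oadd_mem[x [_ [qx [a Oa <-] E]]].
have [n nE] := norm_alg x.
have : fracideal_ideal p (norm x).
  rewrite nE; apply: PLp; apply: extend_mem.
  by rewrite -(above_contract Pq) /= -nE; exact: norm_mem.
move=> /(prime_prod_mem pp.1 (fun s => OI_gal s (qO _ qx)))[s psx].
have [[_ p1 _] _] := pp; apply: p1.
by rewrite -(rmorph1 s) E rmorphD rmorphM /=; apply: OmodD => //;
  apply: OmodZ => //; exact: OI_gal.
Qed.

Lemma ord_above P p q i :
  above P p -> above P q -> gal_invariant i -> ord p i = ord q i.
Proof.
move=> Pp Pq inv; have [s ->] := above_transitive Pp Pq.
by rewrite ord_invariant //; case: Pp.
Qed.

Lemma gal_invariantP i :
  (forall P p q, above P p -> above P q -> ord p i = ord q i) ->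
    gal_invariant i.
Proof.
move=> io; apply/(gal_invariantE hL) => s; apply: ord_inj => // p pp.
have [P Pp] := below_ex pp.
(* The valuation at p of the conjugate of i is the valuation of i at a conjugate of p, which lies
   above the same P. *)
have E : p = gal_frac s (gal_frac s^-1%g p).
  by apply: fracideal_inj; rewrite !fracideal_ideal_gal // gal_preVK.
rewrite {1}E ord_gal //; last exact: primef_gal.
by apply: (io P) => //; exact: above_gal.
Qed.

Lemma ord_extend_gt0 P p : primef P -> primef p ->
  above P p <-> 0 < ord p (extend_fracideal L P).
Proof.
move=> pP pp; rewrite -ord_sub //; last by apply: extend_subO;
  exact: primef_integral.
by split=> [[]|].
Qed.

Lemma extend_integral P :
  integral_frac P -> integral_frac (extend_fracideal L P).
Proof. exact: extend_subO. Qed.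

Lemma ord_extend_eq0 P Q p : primef P -> above Q p -> P <> Q ->
  ord p (extend_fracideal L P) = 0.
Proof.
move=> pP Qp PQ; have [_ pp _] := Qp; have ip := primef_integral pP.
have := ord_ge0 hL pp (extend_integral ip); rewrite le_eqVlt => /orP[/eqP //|].
by move=> /(ord_extend_gt0 pP pp) Pp; case: PQ; exact: above_uniq Pp Qp.
Qed.

(** P O_L is invariant, so it has the same valuation at all primes above P; hence the set defining
    [ramification_index] is a singleton and the default 0 is not taken. *)
Lemma ramification_index_ord (P : prime_of K) p : above (frac_of (sval P)) p ->
  (ramification_index L P)%:Z = ord p (extend_fracideal L (frac_of (sval P))).
Proof.
move=> Pp; have [pP pp Pep] := Pp.
have PE : fracideal_ideal (frac_of (sval P)) = sval P.
  by apply: frac_ofK => //; apply: integral_fractional; case: (svalP P) => -[].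
have iP := extend_integral (primef_integral pP).
have := ord_ge0 hL pp iP; case oE: (ord p _) => [e|//] _.
congr Posz; apply: xget_unique.
  move=> m mm Pm.
  have m0 : m <> 0 by apply: Omod_sub_neq0 Pm _; apply: extend_neq0;
    case: (svalP P).
  have mE : fracideal_ideal (frac_of m) = m.
    by apply: frac_ofK => //; apply: integral_fractional => //; case: mm.
  have Pq : above (frac_of (sval P)) (frac_of m).
    split=> //; last by rewrite PE mE.
    by apply: primef_frac_of => //; split=> //; exact: maximal_is_prime.
  have [_ pm _] := Pq.
  have := ord_subX hL _ pm iP; rewrite fracideal_ideal_extend PE mE => sX.
  have := oE; rewrite (ord_above Pp Pq (gal_invariant_extend _)) => {}oE.
  by split; [apply/sX; rewrite oE|rewrite sX oE lez_nat ltnn].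
move=> f fP; have mp : is_maximal_ideal (fracideal_ideal p).
  by apply: prime_is_maximal => //; case: pp.
have [] := fP _ mp; first by rewrite -PE.
have sX n := ord_subX hL n pp iP; rewrite fracideal_ideal_extend PE in sX.
by rewrite !sX oE !lez_nat => fe /negP; rewrite -leqNgt => ef; apply/eqP;
  rewrite eqn_leq fe.
Qed.

Lemma ideal_norm_contract m : m `<=` OI L -> ideal_norm m `<=` contract m.
Proof. by move=> mO; apply: Ospan_sub => a [x mx /= ->]; exact: norm_mem. Qed.

Lemma ideal_norm_gal s m : ideal_norm (gal_pre s m) = ideal_norm m.
Proof.
congr Ospan; apply/seteqP; split=> a [x mx E].
  by exists (s x) => //; rewrite galNorm_gal ?memvf ?mem_gal1.
exists ((s^-1)%g x); first by rewrite /= galVKx.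
by rewrite galNorm_gal ?memvf ?mem_gal1.
Qed.

(* The norm ideal contains a ^+ n for a in P and n the degree, so P is the    *)
(* only prime containing it.                                                 *)
Lemma ideal_norm_prime P p : above P p -> exists2 f, (0 < f)%N &
  ideal_norm (fracideal_ideal p) = fracideal_ideal P ^+ f.
Proof.
move=> Pp; have [pP pp Pep] := Pp; have [[PO P1 Pprime] P0] := pP.
set N := ideal_norm _.
have NP : N `<=` fracideal_ideal P.
  by rewrite -(above_contract Pp); apply: ideal_norm_contract;
    exact: primef_integral.
have NX a : fracideal_ideal P a -> N (a ^+ #|'Gal({:L} / 1)%g|).
  move=> Pa; apply: sub_Ospan; exists a%:A; first by apply: Pep;
    exact: extend_mem.
  rewrite /galNorm (eq_bigr (fun=> a%:A)) => [|s _]; last exact: gal_alg.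
  by rewrite prodr_const -[_%:A]/(in_alg L _) rmorphXn.
have fN : fractional N.
  apply: integral_fractional; first exact: subset_trans NP PO.
  have [a Pa a0] := (Omod_neq0P _).1 P0; apply/Omod_neq0P.
  by exists (a ^+ #|'Gal({:L} / 1)%g|); [exact: NX|rewrite expf_neq0].
pose j := frac_of N; have jE : fracideal_ideal j = N by exact: frac_ofK.
have ij : integral_frac j by rewrite /integral_frac jE;
  exact: subset_trans NP PO.
have : 0 < ord P j by rewrite -ord_sub // jE.
case oE : (ord P j) => [f|//] f0; exists f => //.
rewrite -jE -fracideal_idealMn; congr fracideal_ideal.
apply: ord_inj => // Q pQ; rewrite pmulrn ordMz // (ord_prime hK pQ pP).
have [->|QP] := eqVneq Q P; first by rewrite oE mul1r.
rewrite mul0r; have := ord_ge0 hK pQ ij; rewrite le_eqVlt => /orP[/eqP //|].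
rewrite -ord_sub // jE => NQ; case/eqP: QP; apply: fracideal_inj; apply/esym.
apply: (prime_sub_eq hK pP pQ) => a Pa; have [[_ Q1 Qprime] _] := pQ.
have := NQ _ (NX _ Pa); elim: #|_| => [|n IH]; first by rewrite expr0.
by rewrite exprS => /Qprime[] //; [exact: PO|apply: OIX; exact: PO].
Qed.

End PrimesAbove.

(** * The relative Polya group *)

Section SubgroupClosure.
Variables (A : zmodType) (H : subgrp A).

Lemma subgrp0 : H 0. Proof. by case: (subgrp_closed H). Qed.
Lemma subgrpB x y : H x -> H y -> H (x - y).
Proof. by case: (subgrp_closed H) => _; apply. Qed.
Lemma subgrpN x : H x -> H (- x).
Proof. by rewrite -sub0r; apply: subgrpB; exact: subgrp0. Qed.
Lemma subgrpD x y : H x -> H y -> H (x + y).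
Proof. by move=> Hx Hy; rewrite -[y]opprK; apply: subgrpB => //;
  exact: subgrpN. Qed.
Lemma subgrpMz x (k : int) : H x -> H (x *~ k).
Proof.
move=> Hx; have Hn n : H (x *+ n).
  by elim: n => [|n IH]; [exact: subgrp0|rewrite mulrS; exact: subgrpD].
by case: k => n; [exact: Hn|rewrite NegzE mulrNz; apply: subgrpN; exact: Hn].
Qed.
Lemma subgrp_sum (T : eqType) (r : seq T) (F : T -> A) :
  (forall t, t \in r -> H (F t)) -> H (\sum_(t <- r) F t).
Proof.
move=> HF; rewrite big_seq; elim/big_ind: _ => //;
  [exact: subgrp0|exact: subgrpD].
Qed.

End SubgroupClosure.

Section PolyaGroup.
Variables (K : fieldType) (L : splittingFieldType K).
Variables (hK : numfield K) (hL : numfield L) (galLK : galois 1 {:L}).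
Implicit Types (P Q : fracideal K) (p q i j : fracideal L) (m : Omod L).

Definition primes_above P : seq (fracideal L) :=
  xget [::] [set s | uniq s /\ forall p, p \in s <-> above P p].

(** There are finitely many primes above P: they are those of positive valuation in the
    factorization of P O_L. *)
Lemma primes_aboveP P : primef P ->
  uniq (primes_above P) /\ forall p, p \in primes_above P <-> above P p.
Proof.
move=> pP; rewrite /primes_above; case: xgetP => [s _ //|h].
have [s [us ps s0 _]] := ord_decomposition hL (extend_fracideal L P).
case: (h [seq p <- s | 0 < ord p (extend_fracideal L P)]).
split; first exact: filter_uniq.
move=> p; rewrite mem_filter; split=> [/andP[op /ps pp]|Pp].
  exact/(ord_extend_gt0 hL).
have [_ pp _] := Pp; have /(ord_extend_gt0 hL pP pp) op := Pp.
rewrite op /=; apply: contraTT op => ns.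
by rewrite s0 // ltxx.
Qed.

Definition prime_over P : fracideal L := xget 0 [set p | above P p].

Lemma prime_overP P : primef P -> above P (prime_over P).
Proof.
by move=> /(above_ex hL) [p Pp]; apply: (@xgetI _ 0 [set p | above P p] p Pp).
Qed.

(* Pi_{P^f} for f the residue degree of P; for other f the product is empty. *)
Definition Pi_above P : fracideal L := \sum_(p <- primes_above P) p.

Lemma ord_Pi_above P Q q :
  primef P -> above Q q -> ord q (Pi_above P) = (P == Q)%:Z.
Proof.
move=> pP Qq; have [us sP] := primes_aboveP pP; have [_ pq _] := Qq.
have ps p : p \in primes_above P -> primef p by move/sP => [].
rewrite /Pi_above ord_sum //.
have E p : p \in primes_above P -> ord q p = (q == p)%:Z.
  by move=> /ps pp; rewrite ord_prime.
rewrite (eq_big_seq _ E); have [PQ|PQ] := eqVneq P Q.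
  rewrite (bigD1_seq q) //=; last by apply/sP; rewrite PQ.
  by rewrite eqxx big1 // => p; rewrite eq_sym => /negPf ->.
rewrite big_seq big1 // => p /sP Pp; case: eqP => // qp; case/eqP: PQ.
by apply: (above_uniq hK Pp); rewrite -qp.
Qed.

Lemma gal_invariant_Pi_above P : primef P -> gal_invariant (Pi_above P).
Proof.
move=> pP; apply: (gal_invariantP hK hL) => Q p q Qp Qq.
by rewrite !(@ord_Pi_above P Q).
Qed.

(** The norm ideal P^f lies in the contraction of m, so a^f is in m for each a in P, and then a is
    in m by primality. *)
Lemma above_of_norm m P f : primef P -> is_maximal_ideal m ->
  ideal_norm m = fracideal_ideal P ^+ f ->
  above P (frac_of m) /\ fracideal_ideal (frac_of m) = m.
Proof.
move=> pP mm nm; have mO : m `<=` OI L by case: mm.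
have sub : fracideal_ideal P ^+ f `<=` contract m.
  by rewrite -nm; exact: ideal_norm_contract.
have m0 : m <> 0.
  rewrite -fracideal_idealMn in sub.
  have [b Pb b0] := (Omod_neq0P _).1 (fracidealP (P *+ f)).1.
  by apply/Omod_neq0P; exists b%:A; [exact: sub|rewrite alg_scalar_eq0].
have pm := maximal_is_prime mm.
have fm : fracideal_ideal (frac_of m) = m by apply: frac_ofK => //;
  exact: integral_fractional.
split=> //; split=> //; first exact: primef_frac_of.
rewrite fm; apply/extend_sub => a Pa /=.
have aX n : (fracideal_ideal P ^+ n) (a ^+ n).
  elim: n => [|n IH]; first by rewrite !expr0; exact: OI1.
  by rewrite !exprS; exact: Omul_mem.
have [_ m1 mp] := pm; have := sub _ (aX f); rewrite /=;
  elim: f {nm sub} => [|n IH].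
  by rewrite expr0 scale1r.
rewrite exprS alg_scalarM => /mp[] //; have Oa := primef_integral pP Pa.
  exact: OI_in_alg.
by apply: OI_in_alg; exact: OIX.
Qed.

(** The primes above P are conjugate, hence have equal norms, so the norm condition with this f
    selects all of them. *)
Lemma Pi_ideal_above P p f : above P p ->
  ideal_norm (fracideal_ideal p) = fracideal_ideal P ^+ f ->
  Pi_ideal L (fracideal_ideal P) f = fracideal_ideal (Pi_above P).
Proof.
move=> Pp nP; have [pP _ _] := Pp; have [us sP] := primes_aboveP pP.
rewrite /Pi_above fracideal_ideal_sum -[RHS](big_map (@fracideal_ideal L) predT id).
rewrite fsbig_seq; last by rewrite map_inj_uniq //; exact: fracideal_inj.
apply: eq_fsbigl; apply/seteqP; split=> m /=.
  move=> [mm nm]; have [Pm mE] := above_of_norm pP mm nm.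
  by rewrite -mE; apply: map_f; apply/sP.
move=> /mapP[q /sP Pq ->]; have [_ pq _] := Pq; split.
  by apply: prime_is_maximal => //; case: pq.
have [s ->] := above_transitive hK hL galLK Pp Pq.
by rewrite fracideal_ideal_gal // ideal_norm_gal.
Qed.

Lemma Pi_ideal_cases P f : primef P ->
  Pi_ideal L (fracideal_ideal P) f = 1 \/
  Pi_ideal L (fracideal_ideal P) f = fracideal_ideal (Pi_above P).
Proof.
move=> pP; have [[m [mm nm]]|h] := pselect (exists m,
    is_maximal_ideal m /\ ideal_norm m = fracideal_ideal P ^+ f).
  have [Pm mE] := above_of_norm pP mm nm; right.
  by apply: (Pi_ideal_above Pm); rewrite mE.
left; rewrite /Pi_ideal (_ : [set m | _] = set0) ?fsbig_set0 //.
by apply/seteqP; split=> m //= mm; apply: h; exists m.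
Qed.

Lemma Po_Pi_above P : primef P -> Po L (ideal_class (Pi_above P)).
Proof.
move=> pP; have Pp := prime_overP pP.
have [f f0 nP] := ideal_norm_prime hK Pp.
apply: sub_gen_smallest;
  exists (exist _ (fracideal_ideal P) pP), f, (Pi_above P).
by split=> //=; rewrite (Pi_ideal_above Pp nP).
Qed.

(** Classes of invariant ideals form a subgroup, and it contains each generator since a [Pi_ideal]
    is either trivial or the full product over a prime of K. *)
Lemma Po_classP c : Po L c -> exists2 i, gal_invariant i & c = ideal_class i.
Proof.
pose H :=
  [set c | exists2 i : fracideal L, gal_invariant i & c = ideal_class i].
have H0 : H 0.
  by exists 0; rewrite ?raddf0 // -(raddf0 (@extend_fracideal K L));
    exact: gal_invariant_extend.
move=> /(_ H); apply; split.
  split=> // _ _ [i ii ->] [j jj ->]; exists (i - j); last by rewrite raddfB.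
  exact: gal_invariantB.
move=> _ [[P [pP P0]] [f [i [_ iE ->]]]] /=.
have fP : fracideal_ideal (frac_of P) = P.
  by apply: frac_ofK => //; apply: integral_fractional => //; have [] := pP.
have pP' : primef (frac_of P) by apply: primef_frac_of.
move: iE; rewrite /= -fP; have [->|->] := Pi_ideal_cases f pP' => iE.
  have -> : i = 0 by exact: fracideal_inj.
  by rewrite raddf0; exact: H0.
by exists i => //; rewrite (fracideal_inj iE); exact: gal_invariant_Pi_above.
Qed.

(** Serves for two families: [Pi_above P], and the extension of P to L. *)
Lemma ord_sum_above (F : fracideal K -> fracideal L) (n : fracideal K ->
  int) t Q q :
  uniq t -> above Q q -> (forall P, P \in t -> P <> Q -> ord q (F P) = 0) ->
  ord q (\sum_(P <- t) F P *~ n P) = if Q \in t then ord q (F Q) * n Q else 0.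
Proof.
move=> ut Qq F0; have [_ pq _] := Qq; rewrite ord_sum //.
have FQ P : P \in t -> P != Q -> ord q (F P *~ n P) = 0.
  by move=> Pt /eqP PQ; rewrite ordMz // F0 // mul0r.
case: ifPn => Qt.
  rewrite (bigD1_seq Q) //= ordMz // big_seq_cond big1 ?addr0 // => P /andP[].
  exact: FQ.
by rewrite big_seq big1 // => P Pt; rewrite FQ //; apply: contraNneq Qt => <-.
Qed.

Lemma support_below i : exists t, [/\ uniq t, forall P, P \in t -> primef P &
  forall Q q, above Q q -> Q \notin t -> ord q i = 0].
Proof.
have [s [_ ps s0 _]] := ord_decomposition hL i.
have /choice[b bP] : forall p, exists P, primef p -> above P p.
  move=> p; have [pp|npp] := pselect (primef p); last by exists 0.
  by have [P Pp] := below_ex hK pp; exists P.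
exists (undup [seq b p | p <- s]); split; first exact: undup_uniq.
  by move=> P; rewrite mem_undup => /mapP[p /ps/bP[pP _ _] ->].
move=> Q q Qq; have [_ pq _] := Qq; rewrite mem_undup => nQ.
apply: s0 => //; apply: contraNN nQ => qs; apply/mapP; exists q => //.
exact: above_uniq hK _ _ _ Qq (bP _ pq).
Qed.

(** An invariant ideal has a single valuation above each P, so it is a product of powers of the
    [Pi_above P]. *)
Lemma Po_invariant i : gal_invariant i -> Po L (ideal_class i).
Proof.
move=> inv; have [t [ut pt t0]] := support_below i.
have -> : i = \sum_(P <- t) Pi_above P *~ ord (prime_over P) i.
  apply: ord_inj => // q pq; have [Q Qq] := below_ex hK pq; have [pQ _ _] := Qq.
  rewrite (ord_sum_above _ ut Qq); last first.
    by move=> P /pt pP PQ; rewrite (@ord_Pi_above P Q) //; case: eqP.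
  rewrite (ord_Pi_above pQ Qq) eqxx mul1r; case: ifPn => [_|/(t0 _ _ Qq) //].
  exact: (ord_above hK hL galLK Qq (prime_overP pQ) inv).
rewrite raddf_sum; apply: subgrp_sum => P /pt pP.
by rewrite raddfMz; apply: subgrpMz; exact: Po_Pi_above.
Qed.

(** The ideal of K is the product of the P^k, with k the quotient of the valuation of i above P by
    that of P O_L. *)
Lemma extend_of_ord i : gal_invariant i ->
  (forall P, primef P -> exists k : int,
    ord (prime_over P) i = ord (prime_over P) (extend_fracideal L P) * k) ->
  exists I, i = extend_fracideal L I.
Proof.
move=> inv h; have [t [ut pt t0]] := support_below i.
have /choice[n nP] : forall P, exists k : int, primef P ->
    ord (prime_over P) i = ord (prime_over P) (extend_fracideal L P) * k.
  move=> P; have [pP|npP] := pselect (primef P); last by exists 0.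
  by have [k kE] := h P pP; exists k.
exists (\sum_(P <- t) P *~ n P); rewrite raddf_sum.
under eq_bigr do rewrite raddfMz.
apply: ord_inj => // q pq; have [Q Qq] := below_ex hK pq; have [pQ _ _] := Qq.
rewrite (ord_sum_above _ ut Qq); last first.
  by move=> P /pt pP PQ; exact: (ord_extend_eq0 hK hL pP Qq PQ).
case: ifPn => [_|/(t0 _ _ Qq) //].
rewrite !(ord_above hK hL galLK Qq (prime_overP pQ)) //; first exact: nP.
exact: gal_invariant_extend.
Qed.

End PolyaGroup.

(** * Valuations modulo the ramification indices *)

Section Residues.
Variable e : nat.

(* inZp 1 is not written 1 because 'I_1 has no ring structure. *)
Definition Zmod_of (k : int) : Zmod e := (inZp 1 : 'I_e.-1.+1) *~ k.

Lemma Zmod_ofB : {morph Zmod_of : k l / k - l}.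
Proof. by move=> k l; exact: mulrzBr. Qed.

Lemma Zmod_of_nat n : Zmod_of n%:Z = inZp n :> 'I_e.-1.+1.
Proof.
by rewrite /Zmod_of -pmulrn Zp_mulrn; apply: val_inj; rewrite /= modnMml mul1n.
Qed.

Lemma Zmod_ofK (y : Zmod e) : Zmod_of (nat_of_ord (y : 'I_e.-1.+1))%:Z = y.
Proof. by rewrite Zmod_of_nat valZpK. Qed.

Lemma Zmod_of_eq0 k : (0 < e)%N -> Zmod_of k = 0 <-> exists l, k = e%:Z * l.
Proof.
move=> e0; have nat0 n : Zmod_of n%:Z = 0 <-> (e %| n)%N.
  rewrite Zmod_of_nat; split=> [/(congr1 val)/=|en].
    by rewrite prednK // => /eqP.
  by apply: val_inj => /=; rewrite prednK //; exact/eqP.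
have {nat0} -> : Zmod_of k = 0 <-> (e %| `|k|)%N.
  case: k => n; first exact: nat0.
  by rewrite NegzE abszN -nat0 /Zmod_of mulrNz; split=> [/eqP|->];
    rewrite ?oppr0 // oppr_eq0 => /eqP.
rewrite -[e in X in X <-> _]absz_nat -dvdzE; split=> [/dvdzP[l ->]|[l ->]].
  by exists l; rewrite mulrC.
exact: dvdz_mulr.
Qed.

End Residues.

Section RamificationMap.
Variables (K : fieldType) (L : splittingFieldType K).
Variables (hK : numfield K) (hL : numfield L) (galLK : galois 1 {:L}).
Implicit Types (P Q : fracideal K) (p q i j : fracideal L).

Lemma frac_ofKP (P : prime_of K) : fracideal_ideal (frac_of (sval P)) = sval P.
Proof. by apply: frac_ofK => //; apply: integral_fractional;
  case: (svalP P) => -[]. Qed.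

Lemma primef_frac_ofP (P : prime_of K) : primef (frac_of (sval P)).
Proof. by rewrite /primef frac_ofKP; exact: (svalP P). Qed.

Lemma frac_of_prime_inj : injective (fun P : prime_of K => frac_of (sval P)).
Proof.
move=> P Q /(congr1 (@fracideal_ideal K)); rewrite !frac_ofKP.
case: P Q => [P hP] [Q hQ] /= E; case: _ / E hQ => hQ.
by congr exist; exact: Prop_irrelevance.
Qed.

(** Evaluated at one chosen prime above P; for invariant i the choice does not matter, by
    [ord_above]. *)
Definition residue_at i :
  dprod_type (fun P : prime_of K => Zmod (ramification_index L P)) :=
  fun P : prime_of K => Zmod_of _ (ord (prime_over L (frac_of (sval P))) i).

Lemma primef_prime_over P : primef P -> primef (prime_over L P).
Proof. by move/(prime_overP hL) => []. Qed.

Lemma prime_over_inj P Q : primef P -> primef Q ->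
  prime_over L P = prime_over L Q -> P = Q.
Proof.
move=> pP pQ E; apply: (above_uniq hK (prime_overP hL pP)).
by rewrite E; exact: (prime_overP hL).
Qed.

Lemma residue_at_finite i : subgrp_mem (Subgrp
  (@dsum_closed _ (fun P : prime_of K =>
    Zmod (ramification_index L P)))) (residue_at i).
Proof.
apply/asboolP => /=; have [s [_ ps s0 _]] := ord_decomposition hL i.
pose f (P : prime_of K) := prime_over L (frac_of (sval P)).
apply: (@sub_finite_set _ _ (f @^-1` [set` s])).
  move=> P /= P0; apply: contrapT => /negP nfs; apply: P0.
  rewrite /residue_at s0 //; apply: primef_prime_over; exact: primef_frac_ofP.
apply: finite_preimage; last exact: finite_seq.
move=> P Q _ _ /prime_over_inj E; apply: frac_of_prime_inj; apply: E;
  exact: primef_frac_ofP.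
Qed.

Definition residues_map i :
  ramification_sum L := Sub (residue_at i) (residue_at_finite i).

Lemma residues_map_is_additive : zmod_morphism residues_map.
Proof.
move=> i j; apply: val_inj; apply: functional_extensionality_dep => P.
rewrite /= /residue_at ordB ?Zmod_ofB //.
by apply: primef_prime_over; exact: primef_frac_ofP.
Qed.

End RamificationMap.

Section RamificationKernel.
Variables (K : fieldType) (L : splittingFieldType K).
Variables (hK : numfield K) (hL : numfield L) (galLK : galois 1 {:L}).
Implicit Types (P Q : fracideal K) (p q i j : fracideal L).

Lemma ramification_index_over (P0 : prime_of K) (P := frac_of (sval P0)) :
  (ramification_index L P0)%:Z = ord (prime_over L P) (extend_fracideal L P)
  /\ (0 < ramification_index L P0)%N.
Proof.
have pP := primef_frac_ofP hK P0; have Pp := prime_overP hL pP.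
have E := ramification_index_ord hK hL galLK Pp; split=> //.
by rewrite -ltz_nat E; apply/(ord_extend_gt0 hL) => //; case: Pp.
Qed.

Lemma residues_map_extend I : residues_map hK hL (extend_fracideal L I) = 0.
Proof.
apply: val_inj; apply: functional_extensionality_dep => P0.
have [eE e0] := ramification_index_over P0; have pP := primef_frac_ofP hK P0.
apply/Zmod_of_eq0 => //; rewrite eE; set P := frac_of (sval P0).
have [s [us ps _ ->]] := ord_decomposition hK I.
rewrite raddf_sum; under eq_bigr do rewrite raddfMz.
rewrite (ord_sum_above hL _ us (prime_overP hL pP)); last first.
  by move=> Q /ps pQ QP;
    exact: (ord_extend_eq0 hK hL pQ (prime_overP hL pP) QP).
by case: ifP => _; [eexists|exists 0; rewrite mulr0].
Qed.

Lemma residues_map_eq0 i : gal_invariant i -> residues_map hK hL i = 0 ->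
  exists I, i = extend_fracideal L I.
Proof.
move=> inv i0; apply: (extend_of_ord hK hL galLK) => // P pP.
pose P0 : prime_of K := exist _ (fracideal_ideal P) pP.
have [eE e0] := ramification_index_over P0.
have := congr1 (fun y : ramification_sum L =>
  (val y : dprod_type (fun P : prime_of K =>
    Zmod (ramification_index L P))) P0) i0.
rewrite /= /residue_at /= fracideal_idealK // => /Zmod_of_eq0[//|l ->].
by exists l; rewrite eE /= fracideal_idealK.
Qed.

(** The preimage is the product, over the finite support of y, of the [Pi_above P] raised to integer
    lifts of the components. *)
Lemma residues_map_surj y :
  exists2 i, gal_invariant i & residues_map hK hL i = y.
Proof.
pose F (P : prime_of K) := Zmod (ramification_index L P).
have /asboolP /= Ty := valP y; set T := [set _ | _] in Ty.
have /finite_seqP[t0 t0E] :=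
  finite_image (fun P : prime_of K => frac_of (sval P)) Ty.
pose t := undup t0.
have tP (P : prime_of K) :
  frac_of (sval P) \in t <-> (val y : dprod_type F) P <> 0.
  rewrite mem_undup;
    have -> : (frac_of (sval P) \in t0 : Prop) = [set` t0] (frac_of (sval P))
      by [].
  rewrite -t0E; split=> [[Q TQ /(frac_of_prime_inj hK) <-] //|yP].
  by exists P.
have pt Q : Q \in t -> primef Q.
  rewrite mem_undup => Qt; have : [set` t0] Q by [].
  by rewrite -t0E => -[P _ <-]; exact: primef_frac_ofP.
(* [n Q] is the representative in [0, e_Q) of the component of y at a prime Q, and 0 for other
   ideals. *)
have /choice[n nP] :
  forall Q, exists k : int, forall P : prime_of K, frac_of (sval P) = Q ->
    k = (nat_of_ord ((val y : dprod_type F) P :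
      'I_(ramification_index L P).-1.+1))%:Z.
  move=> Q;
    have [[P PQ]|h] := pselect (exists P : prime_of K, frac_of (sval P) = Q).
    by eexists => P'; rewrite -PQ => /(frac_of_prime_inj hK) ->.
  by exists 0 => P PQ; case: h; exists P.
exists (\sum_(P <- t) Pi_above L P *~ n P).
  have inv P k : P \in t -> gal_invariant (Pi_above L P *~ k).
    move=> /pt pP; apply/(gal_invariantP hK hL) => Q p q Qp Qq.
    have [[_ pp _] [_ pq _]] := (Qp, Qq).
    by rewrite !ordMz // !(ord_Pi_above hK hL _ Qp, ord_Pi_above hK hL _ Qq).
  apply/(gal_invariantP hK hL) => Q p q Qp Qq.
  have [[_ pp _] [_ pq _]] := (Qp, Qq).
  rewrite !ord_sum //; apply: eq_big_seq => P Pt.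
  exact: (ord_above hK hL galLK Qp Qq (inv P _ Pt)).
apply: val_inj; apply: functional_extensionality_dep => P0.
have pP := primef_frac_ofP hK P0; have Pp := prime_overP hL pP.
rewrite /= /residue_at (ord_sum_above hL _ (undup_uniq _) Pp); last first.
  by move=> Q /pt pQ QP; rewrite (ord_Pi_above hK hL pQ Pp); case: eqP QP.
rewrite (ord_Pi_above hK hL pP Pp) eqxx mul1r (nP _ P0 (erefl _)).
case: ifPn => [_|/negP nt]; first exact: Zmod_ofK.
have -> : \val y P0 = 0 by apply: contrapT => /tP.
by rewrite /Zmod_of mulr0z.
Qed.

End RamificationKernel.

(** * Clearing the denominator of an element of a number field *)

Section IntegralMultiple.
Variables (M : fieldType) (hM : numfield M).
Implicit Types x : M.

(* If p has integer coefficients, leading coefficient a, degree n and root x, *)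
(* then a * x is a root of the monic polynomial a ^+ (n - 1) * p (X / a).     *)
Lemma integral_multiple x : exists d, [/\ d != 0, OI M d & OI M (d * x)].
Proof.
have [inj [d hd]] := hM.
have intr_neq0 (n : int) : n != 0 -> n%:~R != 0 :> M.
  by apply: contra_neq => n0; exact: (inj n 0 n0).
have [c [[i0 ci0] c0]] := hd d.+1 (ltnSn d) (fun i => x ^+ i).
pose p := \poly_(i < d.+1) c (inord i).
have px : (map_poly (intr : int -> M) p).[x] = 0.
  rewrite (@horner_coef_wide _ d.+1); last first.
    by rewrite (leq_trans (size_poly _ _)) // size_poly.
  rewrite -[RHS]c0; apply: eq_bigr => i _.
  by rewrite coef_map coef_poly ltn_ord inord_val /= mulrzl.
have p0 : p != 0.
  apply/eqP => p0; have := congr1 (fun p : {poly int} => p`_i0) p0.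
  by rewrite coef_poly ltn_ord inord_val coef0 => c00; rewrite c00 eqxx in ci0.
pose a := lead_coef p; have a0 : a != 0 by rewrite lead_coef_eq0.
exists a%:~R; split; [exact: intr_neq0| |]; first exact: OI_int.
(* A nonzero constant has no root, so p has degree n + 1 >= 1 and the exponents n - i of [q] below
   make sense. *)
have [n pn] : exists n, size p = n.+2.
  case E: (size p) => [|[|n]]; [| |by exists n].
    by move/eqP: E; rewrite size_poly_eq0 (negPf p0).
  have /size_poly1P[b b0 pb] : size p == 1%N by rewrite E.
  by move: px; rewrite pb map_polyC hornerC => /eqP;
    rewrite (negPf (intr_neq0 _ b0)).
have {}px : \sum_(i < n.+1) (p`_i)%:~R * x ^+ i = - (a%:~R * x ^+ n.+1).
  move: px; rewrite (@horner_coef_wide _ n.+2); last first.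
    by rewrite (leq_trans (size_poly _ _)) // pn.
  rewrite big_ord_recr /= coef_map /= -[p`_n.+1]/(p`_(n.+2.-1)) -pn.
  move/eqP; rewrite addr_eq0 => /eqP <-; apply: eq_bigr => i _.
  by rewrite coef_map.
pose q := \poly_(i < n.+1) (p`_i * a ^+ (n - i)) + 'X^(n.+1).
exists q.
  by rewrite monicE lead_coefDr ?lead_coefXn // size_polyXn ltnS size_poly.
rewrite /root rmorphD /= map_polyXn hornerD hornerXn.
rewrite (@horner_coef_wide _ n.+1); last first.
  by rewrite (leq_trans (size_poly _ _)) // size_poly.
rewrite addr_eq0 (eq_bigr (fun i : 'I_n.+1 =>
  a%:~R ^+ n * ((p`_i)%:~R * x ^+ i))).
  by rewrite -mulr_sumr px mulrN exprMn exprSr mulrA -exprSr.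
move=> i _; rewrite coef_map coef_poly ltn_ord /= rmorphM rmorphXn /= exprMn.
have -> : a%:~R ^+ n = a%:~R ^+ (n - i) * a%:~R ^+ i :> M.
  by rewrite -exprD subnK // -ltnS.
by ring.
Qed.

End IntegralMultiple.

(** * Principal ideals and cocycles of units *)

Section PrincipalIdeals.
Variables (M : fieldType) (hM : numfield M).
Implicit Types (x y : M) (i : fracideal M).

Lemma Oprinc_fractional x : x != 0 -> fractional (Oprinc x).
Proof.
move=> x0; split; first exact: Oprinc_neq0.
have [d [d0 Od Odx]] := integral_multiple hM x; exists d; split=> //.
by move=> _ [a Oa <-]; rewrite mulrCA; exact: OIM.
Qed.

Definition princ x : fracideal M := frac_of (Oprinc x).

Lemma fracideal_ideal_princ x : x != 0 -> fracideal_ideal (princ x) = Oprinc x.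
Proof. by move=> x0; apply: frac_ofK => //; exact: Oprinc_fractional. Qed.

Lemma princM x y : x != 0 -> y != 0 -> princ (x * y) = princ x + princ y.
Proof.
move=> x0 y0; apply: fracideal_inj; rewrite fracideal_idealD.
by rewrite !fracideal_ideal_princ ?mulf_neq0 // OprincM.
Qed.

Lemma princ_div x y : x != 0 -> y != 0 -> princ (x / y) = princ x - princ y.
Proof.
move=> x0 y0; apply: (addIr (princ y)); rewrite subrK -princM ?divfK //.
by rewrite mulf_neq0 ?invr_neq0.
Qed.

Lemma princ_eq0 x : x != 0 -> princ x = 0 <-> Ounit_pred x.
Proof.
move=> x0; split=> [E|/asboolP[_ Ox Ox']].
  have {}E : Oprinc x = 1 by rewrite -fracideal_ideal_princ // E.
  apply/asboolP; split=> //; first by rewrite -[OI M]/(Omod_set 1) -E;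
    exact: Oprinc_mem.
  have : (1 : Omod M) 1 by exact: OI1.
  by rewrite -E => -[a Oa ax]; rewrite -[x^-1]mul1r -ax mulfK.
apply: fracideal_inj; rewrite fracideal_ideal_princ //; apply: Omod_eq1.
  exact: Oprinc_subO.
by exists x^-1; rewrite ?mulVf.
Qed.

Lemma princ_eq x y :
  x != 0 -> y != 0 -> princ x = princ y <-> Ounit_pred (x / y).
Proof.
move=> x0 y0; rewrite -princ_eq0 ?mulf_neq0 ?invr_neq0 // princ_div //.
by split=> [->|/eqP]; [rewrite subrr|rewrite subr_eq0 => /eqP].
Qed.

Lemma ideal_class_eq0 i : ideal_class i = 0 <-> exists2 x, x != 0 & i = princ x.
Proof.
rewrite -(raddf0 (@ideal_class M)) /ideal_class quot_piP subr0.
split=> -[x x0 E]; exists x => //; last by rewrite /= E fracideal_ideal_princ.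
by apply: fracideal_inj; rewrite fracideal_ideal_princ.
Qed.

End PrincipalIdeals.

Lemma extend_fracideal_princ (K : fieldType) (L : fieldExtType K) (a : K) :
  numfield K -> numfield L -> a != 0 ->
  extend_fracideal L (princ a) = princ a%:A.
Proof.
move=> hK hL a0; apply: fracideal_inj.
rewrite fracideal_ideal_extend !fracideal_ideal_princ ?alg_scalar_eq0 //.
exact: extend_princ.
Qed.

Section UnitCocycles.
Variables (K : fieldType) (L : splittingFieldType K).
Variables (hK : numfield K) (hL : numfield L) (galLK : galois 1 {:L}).
Local Notation G := (gal_of {:L}).
Implicit Types (x y : L) (c : {ffun G -> Ounit L}) (s t : G).

(* c is the coboundary of x in L^*. *)
Definition trivialized c x := x != 0 /\ forall s, val (c s) = s x / x.

Lemma Ounit_neq0 (u : Ounit L) : val u != 0.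
Proof. by case: u => u /= /asboolP[]. Qed.

Lemma trivializedB c c' x y : trivialized c x -> trivialized c' y ->
  trivialized (c - c') (x / y).
Proof.
move=> [x0 cx] [y0 cy]; split; first by rewrite mulf_neq0 ?invr_neq0.
move=> s; rewrite !ffunE -[val _]/(val (c s) / val (c' s)) cx cy.
rewrite rmorphM fmorphV /=; field.
by rewrite fmorph_eq0 x0 y0.
Qed.

Lemma trivialized_cocycle c x : trivialized c x -> cocycle L c.
Proof.
move=> [x0 cx] s t; apply: val_inj.
rewrite -[val (c t + _)]/(val (c t) * t (val (c s))) !cx galMx rmorphM fmorphV /=.
by field; rewrite fmorph_eq0 x0.
Qed.

(* By independence of characters some b = \sum_s c_s * s a is nonzero; the *)
(* cocycle identity reads b = c_t * t b.                                   *)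
Lemma hilbert90 c : cocycle L c -> exists x, trivialized c x.
Proof.
move=> cc;
  have [//||a _ b0] :=
    @gal_independent_contra _ _ {:L} predT (fun s => val (c s)) 1%g.
  exact: Ounit_neq0.
set b := \sum_(s | _) _ in b0.
have tb t : b = val (c t) * t b.
  rewrite /b rmorph_sum mulr_sumr (reindex_inj (mulIg t)) /=;
    apply: eq_bigr => s _.
  by rewrite cc -[val (c t + _)]/(val (c t) * t (val (c s))) galMx rmorphM mulrA.
exists b^-1; split=> [|t]; first by rewrite invr_eq0.
by rewrite fmorphV invrK [in X in _ * X](tb t) mulrCA mulVf ?mulr1 // fmorph_eq0.
Qed.

(** If c is also the coboundary of a unit u, then x / u is fixed by G and so lies in K. *)
Lemma trivialized_coboundary c x : trivialized c x ->
  coboundary L c <-> exists a, exists2 u, Ounit_pred u & a != 0 /\ x = u * a%:A.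
Proof.
move=> [x0 cx]; split=> [[u cu]|[a [u uu [a0 xE]]]].
  have u0 := Ounit_neq0 u.
  have [|a E] := @gal_fixed_alg _ _ (x / val u) galLK.
    move=> s;
      have -> : s (x / val u) = s x / s (val u) by rewrite rmorphM fmorphV.
    have : s x / x = s (val u) / val u by rewrite -cx cu.
    by move/(canRL (divfK x0)) ->; field; rewrite fmorph_eq0 u0.
  exists a, (val u); first exact: (valP u).
  split; last by rewrite -E mulrC divfK.
  by rewrite -(alg_scalar_eq0 L) -E mulf_neq0 ?invr_neq0.
exists (Sub u uu) => s; apply: val_inj; rewrite cx /=.
by rewrite -[RHS]/(s u / u) xE rmorphM /= gal_alg invfM mulrACA divff ?mulr1 // alg_scalar_eq0.
Qed.

(** Invariance of (x) means that s x and x generate the same ideal, that is, s x / x is a unit for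
    every s. *)
Lemma gal_invariant_princ x : x != 0 ->
  gal_invariant (princ x) <-> exists c, trivialized c x.
Proof.
move=> x0; have sx0 s : s x != 0 by rewrite fmorph_eq0.
have E s :
  gal_pre s (fracideal_ideal (princ (s x))) = fracideal_ideal (princ x).
  by rewrite !fracideal_ideal_princ // gal_pre_princ.
split=> [inv|[c [_ cx]] s].
  have uP s : Ounit_pred (s x / x).
    apply/(princ_eq hL) => //; apply: fracideal_inj.
    by rewrite -[LHS](gal_preK s) E -[in LHS](inv s) gal_preK.
  exists [ffun s : G => Sub (s x / x) (uP s) : Ounit L]; split=> // s.
  by rewrite ffunE.
have : princ (s x) = princ x by apply/(princ_eq hL) => //; rewrite -cx;
  exact: (valP (c s)).
by move=> sE; rewrite -[in LHS]sE E.
Qed.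

End UnitCocycles.

(** Compatibility with differences and triviality at 0 make the relation single-valued, so it is the
    graph of a homomorphism. *)
Lemma additive_of_rel (A B : zmodType) (R : A -> B -> Prop) :
  (forall a, exists b, R a b) ->
  (forall a b a' b', R a b -> R a' b' -> R (a - a') (b - b')) ->
  (forall b, R 0 b -> b = 0) ->
  exists f : {additive A -> B}, forall a b, R a b <-> f a = b.
Proof.
move=> /choice[f fP] RB R0.
have funR a b b' : R a b -> R a b' -> b = b'.
  by move=> Rb Rb'; apply/eqP; rewrite -subr_eq0 (R0 (b - b')) // -(subrr a);
    exact: RB.
have fB : zmod_morphism f.
  by move=> a a'; apply: funR (fP _) _; exact: RB.
pose g : {additive A -> B} :=
  HB.pack f (GRing.isZmodMorphism.Build _ _ f fB).
exists g => a b; split=> [|<-]; [exact: funR (fP a)|exact: fP].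
Qed.

(** * The exact sequence *)

Section Subquotients.
Variables (A : zmodType) (H N : subgrp A).

Definition represents (x : A) (z : subquot_type H N) :=
  exists2 h : subgrp_type H, val h = x & z = quot_pi _ h.

Lemma represents_sub x z : represents x z -> H x.
Proof. by move=> [h <- _]; exact/asboolP/(valP h). Qed.

Lemma represents_total z : exists x, represents x z.
Proof. by exists (val (quot_repr z)), (quot_repr z); rewrite ?quot_reprK. Qed.

Lemma represents_ex x : H x -> exists z, represents x z.
Proof.
move=> Hx; have Px : subgrp_mem H x by exact/asboolP.
by exists (quot_pi _ (Sub x Px : subgrp_type H)), (Sub x Px).
Qed.

Lemma representsB x y z w : represents x z -> represents y w ->
  represents (x - y) (z - w).
Proof. by move=> [h <- ->] [k <- ->]; exists (h - k); rewrite raddfB. Qed.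

Lemma represents_eq0 x z : represents x z -> z = 0 <-> N x.
Proof.
by move=> [h <- ->];
  rewrite -(raddf0 (@quot_pi _ _)) quot_piP /= /preimage /= subr0.
Qed.

End Subquotients.

Section ExactSequence.
Variables (K : fieldType) (L : splittingFieldType K).
Variables (hK : numfield K) (hL : numfield L) (galLK : galois 1 {:L}).
Local Notation G := (gal_of {:L}).
Local Notation rho := (residues_map hK hL).
Implicit Types (x : L) (c : {ffun G -> Ounit L}).

(** An ideal I that becomes principal in L, say I O_L = (x), is sent to the class of the cocycle s x
    / x. *)
Definition ker_to_H1 (k : subgrp_type (subgrp_ker (@epsilon K L))) (h :
  H1_units L) :=
  exists I x c, [/\ val k = ideal_class I, extend_fracideal L I = princ x,
    trivialized c x & represents c h].

Definition H1_to_sum (h : H1_units L) (y : ramification_sum L) :=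
  exists c x, [/\ represents c h, trivialized c x & y = rho (princ x)].

Definition sum_to_Po (y : ramification_sum L)
    (z : subquot_type (Po L) (subgrp_im (@epsilon K L))) :=
  exists i, [/\ gal_invariant i, y = rho i & represents (ideal_class i) z].

Lemma princ_split a (u : L) : Ounit_pred u -> a != 0 ->
  princ (u * a%:A) = extend_fracideal L (princ a).
Proof.
move=> uu a0; have u0 : u != 0 by case/asboolP: uu.
by rewrite princM ?alg_scalar_eq0 // extend_fracideal_princ // ((princ_eq0 hL u0).2 uu) add0r.
Qed.

Lemma ker_to_H1_total k : exists h, ker_to_H1 k h.
Proof.
pose I := quot_repr (val k);
  have kI : val k = ideal_class I by rewrite /ideal_class quot_reprK.
have /asboolP /= := valP k;
  rewrite kI epsilonE => /(ideal_class_eq0 hL)[x x0 xI].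
have [] := (gal_invariant_princ hL x0).1; first by rewrite -xI;
  exact: gal_invariant_extend.
move=> c cx;
  have [h ch] := represents_ex (coboundary L) (trivialized_cocycle cx).
by exists h, I, x, c.
Qed.

Lemma ker_to_H1B k h k' h' : ker_to_H1 k h -> ker_to_H1 k' h' ->
  ker_to_H1 (k - k') (h - h').
Proof.
move=> [I [x [c [kI xI cx ch]]]] [I' [x' [c' [kI' xI' cx' ch']]]].
exists (I - I'), (x / x'), (c - c'); split.
- by rewrite -[val _]/(val k - val k') kI kI' raddfB.
- by rewrite (raddfB (@extend_fracideal K L)) /= xI xI' princ_div //;
  [case: cx|case: cx'].
- exact: trivializedB.
- exact: representsB.
Qed.

(** One direction makes the map well defined, the other makes it injective: the cocycle of x is a
    coboundary exactly when x is a unit times some a in K^*, that is, when I = (a). *)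
Lemma ker_to_H1_eq0 k h : ker_to_H1 k h -> h = 0 <-> k = 0.
Proof.
move=> [I [x [c [kI xI cx ch]]]];
  rewrite (represents_eq0 ch) (trivialized_coboundary galLK cx).
split=> [[a [u uu [a0 xE]]]|k0].
  apply: val_inj; rewrite kI raddf0; apply/(ideal_class_eq0 hK); exists a => //.
  by apply: (@extend_fracideal_inj _ L); rewrite xI xE princ_split.
have x0 : x != 0 by case: cx.
move: kI; rewrite k0 raddf0 => /esym/(ideal_class_eq0 hK)[a a0 aI].
exists a, (x / a%:A); last by rewrite divfK ?alg_scalar_eq0.
by apply/(princ_eq hL);
  rewrite ?alg_scalar_eq0 // -xI aI extend_fracideal_princ.
Qed.

Lemma H1_to_sum_total h : exists y, H1_to_sum h y.
Proof.
have [c ch] := represents_total h; have [x cx] := hilbert90 (represents_sub ch).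
by exists (rho (princ x)), c, x.
Qed.

Lemma H1_to_sumB h y h' y' : H1_to_sum h y -> H1_to_sum h' y' ->
  H1_to_sum (h - h') (y - y').
Proof.
move=> [c [x [ch cx ->]]] [c' [x' [ch' cx' ->]]]; exists (c - c'), (x / x');
  split.
- exact: representsB.
- exact: trivializedB.
- by rewrite princ_div //;
  [rewrite residues_map_is_additive|case: cx|case: cx'].
Qed.

Lemma H1_to_sum0 y : H1_to_sum 0 y -> y = 0.
Proof.
move=> [c [x [ch cx ->]]].
have := (represents_eq0 ch).1 erefl.
move=> /(trivialized_coboundary galLK cx)[a [u uu [a0 ->]]].
by rewrite princ_split // residues_map_extend.
Qed.

Lemma sum_to_Po_total y : exists z, sum_to_Po y z.
Proof.
have [i inv iy] := residues_map_surj hK hL galLK y.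
have [z iz] :=
  represents_ex (subgrp_im (@epsilon K L)) (Po_invariant hK hL galLK inv).
by exists z, i.
Qed.

Lemma sum_to_PoB y z y' z' : sum_to_Po y z -> sum_to_Po y' z' ->
  sum_to_Po (y - y') (z - z').
Proof.
move=> [i [inv -> iz]] [i' [inv' -> iz']]; exists (i - i'); split.
- exact: gal_invariantB.
- by rewrite residues_map_is_additive.
- by rewrite raddfB; exact: representsB.
Qed.

Lemma sum_to_Po0 z : sum_to_Po 0 z -> z = 0.
Proof.
move=> [i [inv /esym/(residues_map_eq0 galLK inv)[I ->] /represents_eq0 ->]].
by exists (ideal_class I) => //; exact: epsilonE.
Qed.

(** An invariant (x) with all valuations divisible by the e_P is extended from an ideal I of K, and
    the class of I then lies in Ker(epsilon). *)
Lemma H1_to_sum_eq0 h : H1_to_sum h 0 <-> exists k, ker_to_H1 k h.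
Proof.
split=> [[c [x [ch cx /esym x0]]]|[k [I [x [c [kI xI cx ch]]]]]].
  have xn0 : x != 0 by case: cx.
  have inv : gal_invariant (princ x) by apply/(gal_invariant_princ hL xn0);
    exists c.
  have [I xI] := residues_map_eq0 galLK inv x0.
  have Ik : subgrp_mem (subgrp_ker (@epsilon K L)) (ideal_class I).
    by apply/asboolP; rewrite /= epsilonE; apply/(ideal_class_eq0 hL); exists x.
  by exists (Sub (ideal_class I) Ik), I, x, c.
by exists c, x; rewrite -xI residues_map_extend.
Qed.

(** If the class of i comes from K, then i = (x) I O_L with (x) again invariant, and i has the same
    residues as (x). *)
Lemma sum_to_Po_eq0 y : sum_to_Po y 0 <-> exists h, H1_to_sum h y.
Proof.
split=> [[i [inv yi iz]]|[h [c [x [ch cx ->]]]]].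
  have [d _ iI] := (represents_eq0 iz).1 erefl.
  pose I := quot_repr d.
  have {}iI : ideal_class (extend_fracideal L I) = ideal_class i.
    by rewrite -epsilonE /ideal_class quot_reprK.
  have /(ideal_class_eq0 hL)[x x0 xE] :
    ideal_class (i - extend_fracideal L I) = 0.
    by rewrite (raddfB (@ideal_class L)) /= iI subrr.
  have [|c cx] := (gal_invariant_princ hL x0).1.
    by rewrite -xE; apply: gal_invariantB => //; exact: gal_invariant_extend.
  have [h ch] := represents_ex (coboundary L) (trivialized_cocycle cx).
  exists h, c, x; split=> //.
  by rewrite -xE residues_map_is_additive residues_map_extend // subr0.
have x0 : x != 0 by case: cx.
have inv : gal_invariant (princ x) by apply/(gal_invariant_princ hL x0);
  exists c.
have [z xz] :=
  represents_ex (subgrp_im (@epsilon K L)) (Po_invariant hK hL galLK inv).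
exists (princ x); split=> //; have <- // : z = 0.
apply/(represents_eq0 xz); have -> : ideal_class (princ x) = 0.
  by apply/(ideal_class_eq0 hL); exists x.
exact: subgrp0.
Qed.

Lemma sum_to_Po_surj z : exists y, sum_to_Po y z.
Proof.
have [d dz] := represents_total z.
have [i inv E] := Po_classP hK hL galLK (represents_sub dz).
by exists (rho i), i; split=> //; rewrite -E.
Qed.

Lemma ramification_exact_sequence :
  exists (d0 : {additive subgrp_type (subgrp_ker (@epsilon K L)) -> H1_units L})
         (d1 : {additive H1_units L -> ramification_sum L})
         (d2 : {additive ramification_sum L ->
                         subquot_type (Po L) (subgrp_im (@epsilon K L))}),
    [/\ injective d0, exact_at d0 d1, exact_at d1 d2
      & forall z, exists y, d2 y = z].
Proof.
have [d0 d0P] := additive_of_rel ker_to_H1_total ker_to_H1B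
  (fun h kh => (ker_to_H1_eq0 kh).2 erefl).
have [d1 d1P] := additive_of_rel H1_to_sum_total H1_to_sumB H1_to_sum0.
have [d2 d2P] := additive_of_rel sum_to_Po_total sum_to_PoB sum_to_Po0.
exists d0, d1, d2; split.
- by apply: raddf_inj => k /d0P kh; apply/(ker_to_H1_eq0 kh).
- apply/seteqP; split=> h /=.
    by move=> [k _ /d0P kh]; apply/d1P/H1_to_sum_eq0; exists k.
  by move=> /d1P/H1_to_sum_eq0[k /d0P kh]; exists k.
- apply/seteqP; split=> y /=.
    by move=> [h _ /d1P hy]; apply/d2P/sum_to_Po_eq0; exists h.
  by move=> /d2P/sum_to_Po_eq0[h /d1P hy]; exists h.
- by move=> z; have [y /d2P yz] := sum_to_Po_surj z; exists y.
Qed.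

End ExactSequence.

Theorem theorem2p2 (K : fieldExtType rat) (L : splittingFieldType K)
    (galLK : galois 1%VS {:L}) :
  exists (d0 : {additive subgrp_type (subgrp_ker (@epsilon K L)) ->
                         H1_units L})
         (d1 : {additive H1_units L -> ramification_sum L})
         (d2 : {additive ramification_sum L ->
                         subquot_type (Po L) (subgrp_im (@epsilon K L))}),
    [/\ injective d0, exact_at d0 d1, exact_at d1 d2
      & forall z, exists y, d2 y = z].
Proof.
apply: ramification_exact_sequence => //; first exact: numfield_ext.
(* L is seen as a finite extension of Q through the tower L/K/Q. *)
exact: (numfield_ext (baseFieldType L)).
Qed.
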